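(* Let $(\mathcal{A},* )$ be a finite quasigroup with $|\mathcal{A}|=N$, and let $\Phi:\mathcal{A}^{\mathbb{Z}}\to\mathcal{A}^{\mathbb{Z}}$ be the corresponding quasigroup cellular automaton, $\Phi(\mathbf{a})_z=a_z*a_{z+1}$. Let $\mu$ be a Borel probability measure on $\mathcal{A}^{\mathbb{Z}}$ which is $\Phi$-invariant and $\sigma$-ergodic. Then there is some $K\in\{1,\ldots,N\}$ such that (a) $h_\mu(\Phi)=\log_2(K)$; (b) $\Phi$ is $K$-to-1 ($\mu$-a.e.).
   Context: A quasigroup is a finite set $\mathcal{A}$ with a binary operation $*$ such that $a*b=a*c$ implies $b=c$, and $b*a=c*a$ implies $b=c$. $\mathcal{A}^{\mathbb{Z}}$ has the product topology ($\mathcal{A}$ discrete); $\sigma$ is the shift on $\mathcal{A}^{\mathbb{Z}}$, $\sigma(\mathbf{a})_z=a_{z-1}$. ''$\sigma$-ergodic'' means $\sigma$-invariant and ergodic for $\sigma$. $h_\mu(\Phi)$ is the measure-theoretic entropy (logarithms base 2) of $(\mathcal{A}^{\mathbb{Z}},\Phi,\mu)$. $\Phi$ is called $K$-to-1 ($\mu$-a.e.) if there is a (measurable) subset $\mathcal{U}\subset\mathcal{A}^{\mathbb{Z}}$ such that: (1) $\mu[\mathcal{U}]=1$; (2) $\Phi^{-1}(\mathcal{U})$ and $\mathcal{U}$ agree up to a set of $\mu$-measure zero; (3) $\mu$-almost every $\mathbf{u}\in\mathcal{U}$ has exactly $K$ preimages in $\mathcal{U}$, i.e. $|\mathcal{U}\cap\Phi^{-1}\{\mathbf{u}\}|=K$.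 *)

(* Defs.v *)
From HB Require Import structures.
From mathcomp Require Import all_boot all_order all_algebra.
From mathcomp Require Import all_classical all_reals all_analysis.

Set Implicit Arguments.
Unset Strict Implicit.
Unset Printing Implicit Defensive.

Import Order.TTheory GRing.Theory Num.Theory.
Import numFieldNormedType.Exports.

Local Open Scope classical_set_scope.
Local Open Scope ring_scope.

(* Measurable types are pointed in MathComp-Analysis, hence so must be the
   alphabet. No case is lost: there is no probability measure on A^Z when A is
   empty, and the choice of the point plays no role. *)
#[short(type="finPointedType")]
HB.structure Definition FinPointed := {A of Finite A & Pointed A}.

Definition quasigroup_law (A : Type) (op : A -> A -> A) : Prop :=
  right_injective op /\ left_injective op.

Definition config (A : choiceType) : Type := {ptws int -> discrete_topology A}.

Definition borel_config (A : finPointedType) : Type :=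
  g_sigma_algebraType (@open (config A)).

HB.instance Definition _ (A : choiceType) := Topological.on (config A).
HB.instance Definition _ (A : finPointedType) :=
  Measurable.on (borel_config A).

Definition config_shift (A : finPointedType) (a : borel_config A) :
  borel_config A := fun z => a (z - 1).

Definition quasigroup_ca (A : finPointedType) (op : A -> A -> A)
    (a : borel_config A) : borel_config A :=
  fun z => op (a z) (a (z + 1)).

Section measurability.
Variable A : finPointedType.

Let continuous_local_map (i j : int -> int) (g : A -> A -> A) :
  continuous ((fun a z => g (a (i z)) (a (j z))) : config A -> config A).
Proof.
move=> a.
have pc k : nbhs (a : config A) [set b : config A | b k = a k].
  have := @proj_continuous _ (fun=> discrete_topology A) k a.
  by move=> /(_ _ (discrete_set1 (a k : discrete_topology A))).
pose h (b : config A) : config A := fun z => g (b (i z)) (b (j z)).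
have hP := @cvg_sup (int -> A) int (fun k => Topological.class (initial_topology
  (fun b : int -> discrete_topology A => b k))) (h @ (nbhs a)) (h a).
refine (snd (hP _) _) => z U [V [[W _ <-] Wa] /filterS]; apply.
apply: filterS (filterI (pc (i z)) (pc (j z))) => b [bi bj].
have hE : h b z = h a z by congr (g _ _); [exact: bi|exact: bj].
by rewrite /preimage /= hE.
Qed.

Lemma measurable_continuous_config (f : config A -> config A) :
  continuous f ->
  measurable_fun [set: borel_config A] (f : borel_config A -> borel_config A).
Proof.
move=> /continuousP fc.
apply: (@measurability _ _ (borel_config A) (borel_config A) setT f
  (@open (config A)) erefl) => _ [B oB <-].
by rewrite setTI; apply: sub_sigma_algebra; exact: fc.
Qed.

Lemma measurable_config_shift : measurable_fun setT (@config_shift A).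
Proof.
apply: (@measurable_continuous_config (@config_shift A)).
exact: (@continuous_local_map (fun z => z - 1) id (fun x _ => x)).
Qed.

Lemma measurable_quasigroup_ca (op : A -> A -> A) :
  measurable_fun setT (quasigroup_ca op).
Proof.
apply: (@measurable_continuous_config (quasigroup_ca op)).
exact: (@continuous_local_map id (fun z => z + 1) op).
Qed.

HB.instance Definition _ :=
  isMeasurableFun.Build _ _ _ _ (@config_shift A) measurable_config_shift.
HB.instance Definition _ (op : A -> A -> A) :=
  isMeasurableFun.Build _ _ _ _ (quasigroup_ca op)
    (measurable_quasigroup_ca op).

End measurability.

Section ergodic_theory.
Context (d : measure_display) (T : measurableType d) (R : realType).
Implicit Types (mu : probability T R) (f : {mfun T >-> T}).

Definition invariant_measure mu f : Prop :=
  forall B, measurable B -> mu (f @^-1` B) = mu B.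

Definition ergodic_measure mu f : Prop :=
  invariant_measure mu f /\
  forall B, measurable B -> f @^-1` B = B -> mu B = 0%E \/ mu B = 1%E.

Definition log2 (x : R) : R := ln x / ln 2.

Definition measurable_partition (k : nat) (P : 'I_k -> set T) : Prop :=
  (forall i, measurable (P i)) /\ classical_sets.partition setT P setT.

(* The cell of index w of the common refinement of the partitions f^-i P,
   0 <= i < n; it may be empty. *)
Definition itinerary_cell f (k : nat) (P : 'I_k -> set T) (n : nat)
    (w : {ffun 'I_n -> 'I_k}) : set T :=
  [set x | forall i : 'I_n, P (w i) (iter i f x)].

(* Null cells do not contribute, since 0 * log2 0 = 0 whatever log2 0 is. *)
Definition itinerary_entropy mu f (k : nat) (P : 'I_k -> set T) (n : nat) : R :=
  - \sum_(w : {ffun 'I_n -> 'I_k})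
      fine (mu (itinerary_cell f P w)) *
      log2 (fine (mu (itinerary_cell f P w))).

(* The limit exists, by subadditivity, as soon as mu is f-invariant. *)
Definition partition_entropy mu f (k : nat) (P : 'I_k -> set T) : R :=
  limn (fun n => itinerary_entropy mu f P n / n%:R : R).

Definition entropy mu f : \bar R :=
  ereal_sup [set h | exists (k : nat) (P : 'I_k -> set T),
    measurable_partition P /\ h = (partition_entropy mu f P)%:E].

Definition K_to_1 mu f (K : nat) : Prop :=
  exists U : set T,
    [/\ measurable U,
        mu U = 1%E,
        mu.-negligible (f @^-1` U `+` U) &
        {ae mu, forall u, U u -> (U `&` f @^-1` [set u] #= `I_K)%card}].

End ergodic_theory.

Arguments log2 {R} x.

(* Main.v *)
Require Import Defs.
From HB Require Import structures.
From mathcomp Require Import all_boot all_order all_algebra.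
From mathcomp Require Import all_classical all_reals all_analysis.
From mathcomp Require Import measurable_realfun.
From mathcomp Require Import ring lra zify.

(** Write Phi for the automaton, sigma for the shift and F_n for the window of
    n letters around the origin.

    Fibres. Since the law is a quasigroup law, a configuration a is recovered
    from its letter at 0 together with Phi a, and all letters are possible:
    the fibre of Phi over b is indexed by the alphabet. Let g_w be the density
    of the measure B |-> mu (Phi^-1 B, a_0 = w), i.e. the conditional
    probability, given Phi a = b, of the point of the fibre with letter w at 0.
    The function a |-> g_(a_0) (Phi a) is the conditional probability of a in
    its own fibre, a notion that does not refer to the origin; hence it is
    almost everywhere sigma-invariant (density_cocycle), so constant by
    ergodicity. The points of positive conditional probability in a fibre are
    then equiprobable, and there are K = 1 / c of them, c being the constant:
    this is uniform_fibers_exist, where q b is the set of their letters at 0.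
    The configurations a with a_0 in q (Phi a) form a set of full measure that
    meets every fibre in K points, whence (b).

    Entropy. Let L n be the entropy of a block of n letters. Letters 0 .. n-1
    of a determine and are determined by the letters at 0 of a, Phi a, ..,
    Phi^(n-1) a, so the entropy of Phi with respect to the partition by the
    letter at 0 is the limit of L n / n. By invariance under both maps,
    L (n+1) - L n = H(a_0 | F_n o Phi). If Z is a finite observable that
    determines q, then H(a_0 | Z o Phi) is exactly log2 K, because a_0 is
    uniform on the K letters of q given Phi a. Taking Z = (q, F_n) bounds
    the increment below by log2 K and above by log2 K + H(q | F_n), and the
    last term tends to 0. Hence L n / n tends to log2 K.

    For an arbitrary finite partition Y, comparison of itineraries gives
    H(Y^n) <= H(F_m^n) + n H(Y | F_m) <= L (m + n) + n H(Y | F_m), and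
    H(Y | F_m) tends to 0 as m grows; so no partition does better, whence (a).

    All entropies are those of finitely valued maps, and strong subadditivity
    (rv_entropy_submodular) is the basic inequality. The convergence of
    H(Y | F_m) to 0 is obtained from a sigma-algebra argument
    (approximable_sigma_algebra) in place of martingale convergence. *)

Set Implicit Arguments.
Unset Strict Implicit.
Unset Printing Implicit Defensive.

Import Order.TTheory GRing.Theory Num.Theory.
Import numFieldNormedType.Exports.

Local Open Scope classical_set_scope.
Local Open Scope ring_scope.

(** * The function sending x to - x log2 x *)

Section entropy_function.
Context {R : realType}.
Implicit Types x y p : R.

Definition neg_xlog x : R := - (x * log2 x).

Lemma neg_xlog0 : neg_xlog 0 = 0.
Proof. by rewrite /neg_xlog mul0r oppr0. Qed.

Lemma ln2_gt0 : 0 < ln 2 :> R.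
Proof. by rewrite ln_gt0// ltr1n. Qed.

Lemma log2_1 : log2 (1 : R) = 0.
Proof. by rewrite /log2 ln1 mul0r. Qed.

Lemma neg_xlog1 : neg_xlog 1 = 0.
Proof. by rewrite /neg_xlog log2_1 mulr0 oppr0. Qed.

Lemma log2M x y : 0 < x -> 0 < y -> log2 (x * y) = log2 x + log2 y.
Proof. by move=> x0 y0; rewrite /log2 lnM ?posrE// mulrDl. Qed.

Lemma ler_log2 x y : 0 < x -> x <= y -> log2 x <= log2 y.
Proof.
move=> x0 xy; rewrite /log2 ler_pM2r ?invr_gt0 ?ln2_gt0// ler_ln ?posrE//.
exact: lt_le_trans xy.
Qed.

(** The tangent inequality ln t <= t - 1 at t = y / x, the source of
    submodularity and of the bounds near 0 and 1. *)
Lemma log2_div_le x y : 0 < x -> 0 < y ->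
  x * (log2 y - log2 x) <= (y - x) / ln 2.
Proof.
move=> x0 y0; rewrite /log2 -mulrBl mulrA ler_pM2r ?invr_gt0 ?ln2_gt0//.
rewrite -ln_div ?posrE//.
have : ln (1 + (y / x - 1)) <= y / x - 1.
  by apply: le_ln1Dx; rewrite ltrBDl subrr divr_gt0.
rewrite [1 + _]addrC subrK => h.
apply: (le_trans (ler_wpM2l (ltW x0) h)).
by rewrite mulrBr mulr1 mulrC divfK// gt_eqF.
Qed.

Lemma neg_xlog_sum_le (I : finType) (P : pred I) (p : I -> R) :
  (forall i, 0 <= p i) ->
  neg_xlog (\sum_(i | P i) p i) <= \sum_(i | P i) neg_xlog (p i).
Proof.
move=> p0; rewrite /neg_xlog mulr_suml -sumrN; apply: ler_sum => i Pi.
rewrite lerN2; have := p0 i; rewrite le_eqVlt => /predU1P[<-|pi0].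
  by rewrite !mul0r.
rewrite ler_pM2l// ler_log2// (bigD1 i)//= lerDl.
by apply: sumr_ge0.
Qed.

(** The difference of the two sides is the sum of p i j * log2 (p i j * P / (a
    i * b j)), a relative entropy between p and the product a b / P of its
    marginals, which has the same total mass as p. It is nonnegative by the
    tangent inequality applied term by term. The masses are not normalized,
    since this is used with a third variable kept fixed. *)
Lemma neg_xlog_submodular (I J : finType) (p : I -> J -> R) :
  (forall i j, 0 <= p i j) ->
  \sum_i \sum_j neg_xlog (p i j) + neg_xlog (\sum_i \sum_j p i j) <=
  \sum_i neg_xlog (\sum_j p i j) + \sum_j neg_xlog (\sum_i p i j).
Proof.
move=> p0.
set P := \sum_i \sum_j p i j.
pose a i := \sum_j p i j; pose b j := \sum_i p i j.
have Pb : P = \sum_j b j by rewrite /P exchange_big.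
have a0 i : 0 <= a i by apply: sumr_ge0.
have b0 j : 0 <= b j by apply: sumr_ge0.
have P0 : 0 <= P by apply: sumr_ge0 => i _; exact: a0.
have ap i j : p i j <= a i by rewrite /a (bigD1 j)//= lerDl sumr_ge0.
have bp i j : p i j <= b j by rewrite /b (bigD1 i)//= lerDl sumr_ge0.
have aP i : a i <= P.
  by rewrite [P](_ : _ = \sum_i a i)// (bigD1 i)//= lerDl sumr_ge0.
have key i j : p i j * (log2 (a i) + log2 (b j) - log2 (p i j) - log2 P) <=
    (a i * b j / P - p i j) / ln 2.
  have := p0 i j; rewrite le_eqVlt => /predU1P[<-|pij].
    rewrite mul0r subr0; apply: divr_ge0; last exact/ltW/ln2_gt0.
    by apply: divr_ge0 => //; apply: mulr_ge0.
  have ai := lt_le_trans pij (ap i j).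
  have bj := lt_le_trans pij (bp i j).
  have PP := lt_le_trans ai (aP i).
  apply: le_trans (log2_div_le pij (divr_gt0 (mulr_gt0 ai bj) PP)).
  have -> : log2 (a i * b j / P) = log2 (a i) + log2 (b j) - log2 P.
    by rewrite -log2M// /log2 ln_div ?posrE ?mulr_gt0// mulrBl.
  by rewrite le_eqVlt; apply/orP; left; apply/eqP; ring.
have {key}sumkey : \sum_i \sum_j
    p i j * (log2 (a i) + log2 (b j) - log2 (p i j) - log2 P) <= 0.
  apply: le_trans (ler_sum _ (fun i _ => ler_sum _ (fun j _ => key i j))) _.
  under eq_bigr do rewrite -mulr_suml.
  rewrite -mulr_suml pmulr_lle0 ?invr_gt0 ?ln2_gt0//.
  under eq_bigr do rewrite sumrB -mulr_suml -mulr_sumr -/(a _).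
  rewrite sumrB -/P -!mulr_suml -Pb -/P -[X in _ - X]/P.
  have [->|PN] := eqVneq P 0; first by rewrite mulr0 mul0r subrr.
  by rewrite mulfK// subrr.
(* each one-variable term is spread over the sum that defines its marginal *)
have sE : \sum_i \sum_j
    p i j * (log2 (a i) + log2 (b j) - log2 (p i j) - log2 P) =
    \sum_i \sum_j neg_xlog (p i j) + neg_xlog P
    - \sum_i neg_xlog (a i) - \sum_j neg_xlog (b j).
  have -> : \sum_j neg_xlog (b j) = \sum_i \sum_j - (p i j * log2 (b j)).
    rewrite exchange_big; apply: eq_bigr => j _.
    by rewrite /neg_xlog sumrN mulr_suml.
  have -> : \sum_i neg_xlog (a i) = \sum_i \sum_j - (p i j * log2 (a i)).
    by apply: eq_bigr => i _; rewrite /neg_xlog sumrN mulr_suml.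
  have -> : neg_xlog P = \sum_i \sum_j - (p i j * log2 P).
    rewrite /neg_xlog {1}/P mulr_suml -sumrN; apply: eq_bigr => i _.
    by rewrite sumrN mulr_suml.
  rewrite -big_split -!sumrB; apply: eq_bigr => i _ /=.
  rewrite -big_split -!sumrB; apply: eq_bigr => j _ /=.
  by rewrite /neg_xlog; ring.
by move: sumkey; rewrite sE => h; rewrite -subr_le0 opprD addrA.
Qed.

Lemma neg_xlog_le_subr x : 0 <= x -> neg_xlog x <= (1 - x) / ln 2.
Proof.
rewrite le_eqVlt => /predU1P[<-|x0].
  by rewrite neg_xlog0 subr0 divr_ge0// ltW// ln2_gt0.
have := log2_div_le x0 ltr01; rewrite log2_1 sub0r.
by rewrite /neg_xlog mulrN.
Qed.

(** Writing x = s ^ 2 turns - x log2 x into 2 s (- s log2 s), and the last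
    factor is bounded by 1 / ln 2: an explicit form of continuity at 0. *)
Lemma neg_xlog_le_sqrt x : 0 <= x -> neg_xlog x <= 2 * Num.sqrt x / ln 2.
Proof.
rewrite le_eqVlt => /predU1P[<-|x0].
  by rewrite neg_xlog0 divr_ge0// ?mulr_ge0// ltW// ln2_gt0.
set s := Num.sqrt x; have s0 : 0 < s by rewrite sqrtr_gt0.
have -> : neg_xlog x = 2 * s * neg_xlog s.
  rewrite -[in LHS](@sqr_sqrtr _ x) ?ltW// -/s /neg_xlog expr2 log2M//; ring.
rewrite -!mulrA ler_pM2l// ler_pM2l//.
apply: le_trans (neg_xlog_le_subr (ltW s0)) _.
by rewrite ler_pdivrMr ?ln2_gt0// mulVf ?gt_eqF ?ln2_gt0//; lra.
Qed.

End entropy_function.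

(** * Entropy of finite-valued random variables *)

Section entropy_rv.
Context d (T : measurableType d) (R : realType) (mu : probability T R).

Definition finite_rv (I : finType) (X : T -> I) : Prop :=
  forall i, measurable (X @^-1` [set i]).

Definition joint (I J : Type) (X : T -> I) (Y : T -> J) (x : T) : I * J :=
  (X x, Y x).

(** The partition into fibres of Y refines the partition into fibres of X.
    Being stated by equality of values, it requires no factor map to be
    exhibited. *)
Definition determines (I J : Type) (Y : T -> J) (X : T -> I) : Prop :=
  forall x y, Y x = Y y -> X x = X y.

Definition mass (I : finType) (X : T -> I) (i : I) : R :=
  fine (mu (X @^-1` [set i])).

Definition rv_entropy (I : finType) (X : T -> I) : R :=
  \sum_i neg_xlog (mass X i).

(** Conditional entropy is defined by the chain rule, which avoids conditional
    probabilities altogether. *)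
Definition cond_entropy (I J : finType) (X : T -> I) (Y : T -> J) : R :=
  rv_entropy (joint X Y) - rv_entropy Y.

Lemma determines_comp (I J : Type) (Y : T -> J) (X : T -> I) :
  determines Y X -> exists f : J -> I, X = f \o Y.
Proof.
move=> YX.
(* off the range of Y any value will do *)
exists (fun j => match pselect (exists x, Y x = j) with
  | left e => X (sval (cid e)) | right _ => X point end).
apply/funext => x /=; case: pselect => [e|[]]; last by exists x.
by case: cid => y /= /YX.
Qed.

Lemma finite_rv_comp (I J : finType) (Y : T -> J) (f : J -> I) :
  finite_rv Y -> finite_rv (f \o Y).
Proof.
move=> mY i.
rewrite [X in measurable X](_ : _ = \bigcup_(j in [set` [pred j | f j == i]])
    Y @^-1` [set j]); last first.
  apply/seteqP; split=> [x /= fx|x [j /= /eqP <- ->]]//.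
  by exists (Y x) => //=; apply/eqP.
by apply: fin_bigcup_measurable => [|j _]; [exact: finite_finset|exact: mY].
Qed.

Lemma finite_rv_joint (I J : finType) (X : T -> I) (Y : T -> J) :
  finite_rv X -> finite_rv Y -> finite_rv (joint X Y).
Proof.
move=> mX mY [i j]; rewrite [X in measurable X](_ : _ =
    X @^-1` [set i] `&` Y @^-1` [set j]); first exact: measurableI.
apply/seteqP; split=> x /=; first by case=> -> ->.
by case=> XE YE; rewrite /joint XE YE.
Qed.

Lemma finite_rv_preimage (I : finType) (X : T -> I) (B : set I) :
  finite_rv X -> measurable (X @^-1` B).
Proof.
move=> mX; have := finite_rv_comp (fun i => `[< B i >]) mX true.
by congr measurable; apply/seteqP; split=> x /= /asboolP.
Qed.

Lemma finite_rv_mfun (I : finType) (X : T -> I) (f : {mfun T >-> T}) :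
  finite_rv X -> finite_rv (X \o f).
Proof.
move=> mX i; have := @measurable_funPT _ _ _ _ f measurableT _ (mX i).
by rewrite setTI.
Qed.

Definition indicator_rv (B : set T) (x : T) : bool := `[< B x >].

Lemma finite_rv_indicator (B : set T) :
  measurable B -> finite_rv (indicator_rv B).
Proof.
move=> mB [|].
- rewrite (_ : _ @^-1` _ = B)//.
  by apply/seteqP; split=> x /= /asboolP.
- rewrite (_ : _ @^-1` _ = ~` B); first exact: measurableC.
  apply/seteqP; split=> x /=; first by move/negbT/asboolPn.
  by move=> /asboolPn/negbTE.
Qed.

Lemma mass_ge0 (I : finType) (X : T -> I) i : 0 <= mass X i.
Proof. by rewrite fine_ge0. Qed.

Lemma measure_split (I : finType) (X : T -> I) (B : set T) :
  finite_rv X -> measurable B ->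
  fine (mu B) = \sum_i fine (mu (B `&` X @^-1` [set i])).
Proof.
move=> mX mB; rewrite sum_fine => [|i _]; last first.
  by rewrite fin_num_measure//; exact: measurableI.
congr fine; rewrite fsbig_seq ?index_enum_uniq// -measure_fin_bigcup//=.
- congr (mu _); rewrite -setI_bigcupr; apply/seteqP; split=> [x Bx|x []//].
  by split=> //; exists (X x) => //=; rewrite mem_index_enum.
- by apply/trivIsetP => i j _ _ /eqP ij; apply/seteqP; split=> // x;
    case=> -[_ /= Xi] [_ /= Xj]; apply: ij; rewrite -Xi -Xj.
- by move=> i _; exact: measurableI.
Qed.

Lemma mass_marginal (I J : finType) (X : T -> I) (Y : T -> J) j :
  finite_rv X -> finite_rv Y -> mass Y j = \sum_i mass (joint X Y) (i, j).
Proof.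
move=> mX mY; rewrite /mass (measure_split mX (mY j)); apply: eq_bigr => i _.
congr (fine (mu _)); apply/seteqP; split=> x /=; last by case=> -> ->.
by case=> YE XE; rewrite /joint XE YE.
Qed.

Lemma mass_sum1 (I : finType) (X : T -> I) : finite_rv X -> \sum_i mass X i = 1.
Proof.
move=> mX; rewrite -[RHS]/(fine 1%E) -(@probability_setT _ _ _ mu).
rewrite (measure_split mX measurableT).
by apply: eq_bigr => i _; rewrite setTI.
Qed.

(** Each fibre of f merges several masses of Y into one, and - x log2 x is
    subadditive. *)
Lemma rv_entropy_comp_le (I J : finType) (Y : T -> J) (f : J -> I) :
  finite_rv Y -> rv_entropy (f \o Y) <= rv_entropy Y.
Proof.
move=> mY; rewrite {2}/rv_entropy (partition_big f xpredT)//=.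
apply: ler_sum => i _; apply: le_trans (neg_xlog_sum_le _ (@mass_ge0 _ Y)).
rewrite /mass (measure_split mY (finite_rv_comp f mY i)).
rewrite [in leRHS]big_mkcond /= le_eqVlt; apply/orP; left; apply/eqP.
congr neg_xlog; apply: eq_bigr => j _; case: eqP => fj.
  by congr (fine (mu _)); apply/seteqP; split=> x /= => [[]//|Yx]; rewrite Yx.
rewrite (_ : _ `&` _ = set0) ?measure0//.
apply/seteqP; split=> // x /= -[fi Yx].
by apply: fj; rewrite -Yx.
Qed.

Lemma determines_entropy_le (I J : finType) (X : T -> I) (Y : T -> J) :
  finite_rv Y -> determines Y X -> rv_entropy X <= rv_entropy Y.
Proof. by move=> mY /determines_comp[f ->]; exact: rv_entropy_comp_le. Qed.

Lemma determines_entropy_eq (I J : finType) (X : T -> I) (Y : T -> J) :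
  finite_rv X -> finite_rv Y -> determines Y X -> determines X Y ->
  rv_entropy X = rv_entropy Y.
Proof.
by move=> mX mY YX XY; apply/eqP; rewrite eq_le !determines_entropy_le.
Qed.

(** Strong subadditivity: for each fixed value of Z, this is submodularity of
    the unnormalized joint masses of X and Y. *)
Lemma rv_entropy_submodular (I J L : finType)
    (X : T -> I) (Y : T -> J) (Z : T -> L) :
  finite_rv X -> finite_rv Y -> finite_rv Z ->
  rv_entropy (joint (joint X Y) Z) + rv_entropy Z <=
  rv_entropy (joint X Z) + rv_entropy (joint Y Z).
Proof.
move=> mX mY mZ.
have mXZ := finite_rv_joint mX mZ; have mYZ := finite_rv_joint mY mZ.
have mXY := finite_rv_joint mX mY.
pose p i j l := mass (joint (joint X Y) Z) (i, j, l).
have pXZ i l : mass (joint X Z) (i, l) = \sum_j p i j l.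
  rewrite (mass_marginal _ mY mXZ).
  apply: eq_bigr => j _; congr (fine (mu _)).
  by apply/seteqP; split=> x /= [<- <- <-].
have pYZ j l : mass (joint Y Z) (j, l) = \sum_i p i j l.
  rewrite (mass_marginal _ mX mYZ).
  apply: eq_bigr => i _; congr (fine (mu _)).
  by apply/seteqP; split=> x /= [<- <- <-].
have pZ l : mass Z l = \sum_i \sum_j p i j l.
  rewrite (mass_marginal _ mX mZ); apply: eq_bigr => i _; exact: pXZ.
have -> : rv_entropy (joint (joint X Y) Z) =
    \sum_l \sum_i \sum_j neg_xlog (p i j l).
  under [RHS]eq_bigr do rewrite pair_bigA.
  by rewrite exchange_big pair_bigA; apply: eq_bigr => -[[]].
have -> : rv_entropy (joint X Z) = \sum_l \sum_i neg_xlog (\sum_j p i j l).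
  rewrite exchange_big pair_bigA; apply: eq_bigr => -[i l] _ /=.
  by rewrite pXZ.
have -> : rv_entropy (joint Y Z) = \sum_l \sum_j neg_xlog (\sum_i p i j l).
  rewrite exchange_big pair_bigA; apply: eq_bigr => -[i l] _ /=.
  by rewrite pYZ.
rewrite /rv_entropy -!big_split; apply: ler_sum => l _ /=; rewrite pZ.
by apply: neg_xlog_submodular => i j; exact: mass_ge0.
Qed.

End entropy_rv.

(** * Conditional entropy *)

Section cond_entropy.
Context d (T : measurableType d) (R : realType) (mu : probability T R).
Local Notation H := (rv_entropy mu).
Local Notation Hc := (cond_entropy mu).

Lemma determines_joint (I J L : Type) (X : T -> I) (Y : T -> J) (Z : T -> L) :
  determines Z X -> determines Z Y -> determines Z (joint X Y).
Proof. by move=> ZX ZY x y e; congr pair; [exact: ZX|exact: ZY]. Qed.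

Lemma determines_jointl (I J L : Type) (X : T -> I) (Y : T -> J) (Z : T -> L) :
  determines X Z -> determines (joint X Y) Z.
Proof. by move=> XZ x y [/XZ]. Qed.

Lemma determines_jointr (I J L : Type) (X : T -> I) (Y : T -> J) (Z : T -> L) :
  determines Y Z -> determines (joint X Y) Z.
Proof. by move=> XZ x y [_ /XZ]. Qed.

Lemma finite_rv_determined (I J : finType) (X : T -> I) (Y : T -> J) :
  finite_rv Y -> determines Y X -> finite_rv X.
Proof. by move=> mY /determines_comp[f ->]; exact: finite_rv_comp. Qed.

Lemma finite_rv_cst (I : finType) (i : I) : finite_rv (fun _ : T => i).
Proof.
move=> j; have [->|ij] := eqVneq i j.
  rewrite (_ : _ @^-1` _ = setT)//.
  by apply/seteqP; split.
rewrite (_ : _ @^-1` _ = set0)//.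
by apply/seteqP; split => // x /= /eqP; rewrite (negbTE ij).
Qed.

Local Hint Resolve finite_rv_joint finite_rv_cst : core.

Lemma rv_entropy_cst (I : finType) (i : I) : H (fun _ : T => i) = 0.
Proof.
rewrite /rv_entropy big1// => j _; rewrite /mass; have [->|ij] := eqVneq i j.
  rewrite (_ : _ @^-1` _ = setT) ?probability_setT ?neg_xlog1//.
  by apply/seteqP; split.
rewrite (_ : _ @^-1` _ = set0) ?measure0 ?neg_xlog0//.
by apply/seteqP; split => // x /= /eqP; rewrite (negbTE ij).
Qed.

Lemma cond_entropy_ge0 (I J : finType) (X : T -> I) (Y : T -> J) :
  finite_rv X -> finite_rv Y -> 0 <= Hc X Y.
Proof.
move=> mX mY; rewrite subr_ge0 determines_entropy_le//.
  exact: finite_rv_joint.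
exact: determines_jointr.
Qed.

Lemma cond_entropy_determined (I J : finType) (X : T -> I) (Y : T -> J) :
  finite_rv Y -> determines Y X -> Hc X Y = 0.
Proof.
move=> mY YX; have mX := finite_rv_determined mY YX.
apply/eqP; rewrite subr_eq0; apply/eqP; apply: determines_entropy_eq => //.
- exact: finite_rv_joint.
- exact: determines_joint.
- exact: determines_jointr.
Qed.

(** Strong subadditivity for X and Z given Y, where the pair (Z, Y) carries the
    same information as Z. *)
Lemma cond_entropy_le_cond (I J L : finType)
    (X : T -> I) (Y : T -> J) (Z : T -> L) :
  finite_rv X -> finite_rv Z -> determines Z Y -> Hc X Z <= Hc X Y.
Proof.
move=> mX mZ ZY; have mY := finite_rv_determined mZ ZY.
have := rv_entropy_submodular mu mX mZ mY.
have <- : H Z = H (joint Z Y).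
  apply: determines_entropy_eq => //; first exact: finite_rv_joint.
    exact: determines_jointl.
  exact: determines_joint.
have <- : H (joint X Z) = H (joint (joint X Z) Y).
  apply: determines_entropy_eq; [exact: finite_rv_joint| | |].
  - by apply: finite_rv_joint => //; exact: finite_rv_joint.
  - exact: determines_jointl.
  - by apply: determines_joint => //; exact: determines_jointr.
by rewrite /cond_entropy => h; lra.
Qed.

Lemma cond_entropy_mono (I J L : finType)
    (X : T -> I) (Y : T -> J) (Z : T -> L) :
  finite_rv Y -> finite_rv Z -> determines (joint Y Z) X -> Hc X Z <= Hc Y Z.
Proof.
move=> mY mZ YZX; rewrite lerD2r determines_entropy_le//.
  exact: finite_rv_joint.
by apply: determines_joint => //; exact: determines_jointr.
Qed.

Lemma cond_entropy_joint_le (I J L : finType)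
    (X : T -> I) (Y : T -> J) (Z : T -> L) :
  finite_rv X -> finite_rv Y -> finite_rv Z ->
  Hc (joint X Y) Z <= Hc X Z + Hc Y Z.
Proof.
move=> mX mY mZ; have := rv_entropy_submodular mu mX mY mZ.
by rewrite /cond_entropy => h; lra.
Qed.

Lemma cond_entropy_chain (I J L : finType)
    (X : T -> I) (Y : T -> J) (Z : T -> L) :
  finite_rv X -> finite_rv Y -> finite_rv Z ->
  Hc (joint X Y) Z = Hc X (joint Y Z) + Hc Y Z.
Proof.
move=> mX mY mZ; rewrite /cond_entropy addrA subrK; congr (_ - _).
apply: determines_entropy_eq.
- by do 2 ?apply: finite_rv_joint.
- by do 2 ?apply: finite_rv_joint.
- by move=> x y [X_ Y_ Z_]; rewrite /joint X_ Y_ Z_.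
- by move=> x y [X_ Y_ Z_]; rewrite /joint X_ Y_ Z_.
Qed.

Lemma cond_entropy_triangle (I J L : finType)
    (X : T -> I) (Y : T -> J) (Z : T -> L) :
  finite_rv X -> finite_rv Y -> finite_rv Z -> Hc X Z <= Hc X Y + Hc Y Z.
Proof.
move=> mX mY mZ; apply: (@le_trans _ _ (Hc (joint X Y) Z)).
  apply: cond_entropy_mono => //; first exact: finite_rv_joint.
  by do 2 apply: determines_jointl.
rewrite cond_entropy_chain// lerD2r cond_entropy_le_cond//.
  exact: finite_rv_joint.
exact: determines_jointl.
Qed.

Lemma cond_entropy_le (I J : finType) (X : T -> I) (Y : T -> J) :
  finite_rv X -> finite_rv Y -> Hc X Y <= H X.
Proof.
move=> mX mY; apply: (@le_trans _ _ (Hc X (fun _ : T => tt))).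
  by apply: cond_entropy_le_cond.
rewrite /cond_entropy rv_entropy_cst subr0 determines_entropy_le//.
exact: determines_joint.
Qed.

Lemma rv_entropy_invariant (f : {mfun T >-> T}) (I : finType) (X : T -> I) :
  invariant_measure mu f -> finite_rv X -> H (X \o f) = H X.
Proof.
by move=> inv mX; apply: eq_bigr => i _; rewrite /mass -(inv _ (mX i)).
Qed.

Lemma cond_entropy_invariant (f : {mfun T >-> T}) (I J : finType)
    (X : T -> I) (Y : T -> J) :
  invariant_measure mu f -> finite_rv X -> finite_rv Y ->
  Hc (X \o f) (Y \o f) = Hc X Y.
Proof.
move=> inv mX mY; rewrite /cond_entropy -(rv_entropy_invariant inv mY).
by rewrite -(rv_entropy_invariant inv (finite_rv_joint mX mY)).
Qed.

Lemma indicator_rv_eq (B C : set T) (x y : T) :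
  (indicator_rv B x = indicator_rv C y) <-> (B x <-> C y).
Proof.
rewrite /indicator_rv; split=> [e|e].
  by split=> h; apply/asboolP; [rewrite -e|rewrite e]; exact/asboolP.
by apply/idP/idP => /asboolP h; apply/asboolP/e.
Qed.

(** Of the two terms, the one of the complement is at most mu B / ln 2. *)
Lemma rv_entropy_indicator_le (B : set T) : measurable B ->
  H (indicator_rv B) <= (2 * Num.sqrt (fine (mu B)) + fine (mu B)) / ln 2.
Proof.
move=> mB; have mX : finite_rv (indicator_rv B) by exact: finite_rv_indicator.
have := mass_sum1 mu mX; have := mass_ge0 mu (indicator_rv B).
rewrite /rv_entropy !big_bool.
have <- : mass mu (indicator_rv B) true = fine (mu B).
  congr (fine (mu _)); apply/seteqP; split=> x /= /asboolP //.
move: (mass mu _) => p p0 /= pq.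
have q1 := neg_xlog_le_subr (p0 false); have := neg_xlog_le_sqrt (p0 true).
rewrite (_ : 1 - p false = p true) in q1; last by rewrite -pq addrK.
by move=> ?; rewrite [leRHS]mulrDl lerD.
Qed.

Lemma rv_entropy_indicator_small (e : R) : 0 < e -> exists2 t : R, 0 < t &
  forall B, measurable B -> fine (mu B) <= t -> H (indicator_rv B) <= e.
Proof.
move=> e0.
(* p <= c and sqrt p <= c make (2 * sqrt p + p) / ln 2 at most e *)
pose c := e * ln 2 / 3.
have c0 : 0 < c by rewrite divr_gt0// mulr_gt0// ln2_gt0.
exists (Num.min c (c ^+ 2)).
  by rewrite lt_min c0 exprn_gt0.
move=> B mB; rewrite le_min => /andP[Bc Bcc].
apply: (le_trans (rv_entropy_indicator_le mB)).
rewrite ler_pdivrMr ?ln2_gt0//.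
have : Num.sqrt (fine (mu B)) <= c.
  by rewrite -[c](ger0_norm (ltW c0)) -sqrtr_sqr ler_wsqrtr.
have -> : e * ln 2 = 3 * c by rewrite /c; field.
by move=> h; move: Bc h; clear; lra.
Qed.

Lemma cond_entropy_indicatorU (I : finType) (B C : set T) (Z : T -> I) :
  measurable B -> measurable C -> finite_rv Z ->
  Hc (indicator_rv (B `|` C)) Z <=
  Hc (indicator_rv B) Z + Hc (indicator_rv C) Z.
Proof.
move=> mB mC mZ.
have mXB := finite_rv_indicator mB; have mXC := finite_rv_indicator mC.
apply: le_trans (cond_entropy_joint_le mXB mXC mZ).
apply: cond_entropy_mono => //; first exact: finite_rv_joint.
apply: determines_jointl => x y [/indicator_rv_eq xB /indicator_rv_eq xC].
by apply/indicator_rv_eq; split=> -[/xB|/xC]; [left|right|left|right].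
Qed.

(** Knowing C, the set B is recovered from B \ C. *)
Lemma cond_entropy_indicator_approx (B C : set T) :
  measurable B -> measurable C -> C `<=` B ->
  Hc (indicator_rv B) (indicator_rv C) <= H (indicator_rv (B `\` C)).
Proof.
move=> mB mC CB.
have mBC := measurableD mB mC.
have mXB := finite_rv_indicator mB; have mXC := finite_rv_indicator mC.
have mXBC := finite_rv_indicator mBC.
apply: le_trans (cond_entropy_le mXBC mXC).
apply: cond_entropy_mono => // x y [/indicator_rv_eq xBC /indicator_rv_eq xC].
apply/indicator_rv_eq; split=> [Bx|By].
- by have [/xC/CB//|Cx] := pselect (C x); have [] : (B `\` C) y by apply/xBC.
- by have [/xC/CB//|Cy] := pselect (C y); have [] : (B `\` C) x by apply/xBC.
Qed.

(** * Approximation of sets by a filtration *)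

Section filtration.
Variables (J : nat -> finType) (F : forall n, T -> J n).
Hypothesis mF : forall n, finite_rv (F n).
Hypothesis detF : forall m n, (m <= n)%N -> determines (F n) (F m).

(** The sets whose indicator has arbitrarily small entropy given some term of
    the filtration. Conditional entropy thus plays the role of the distance to
    the sets of the filtration. *)
Definition approximable (B : set T) : Prop :=
  measurable B /\
  forall e : R, 0 < e -> exists n, Hc (indicator_rv B) (F n) <= e.

Lemma approximableW B e : approximable B -> 0 < e ->
  exists N, forall n, (N <= n)%N -> Hc (indicator_rv B) (F n) <= e.
Proof.
move=> [mB aB] /aB[N BN]; exists N => n Nn; apply: le_trans BN.
by apply: cond_entropy_le_cond (detF Nn) => //; exact: finite_rv_indicator.
Qed.

Lemma approximable_determined n B :
  determines (F n) (indicator_rv B) -> approximable B.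
Proof.
move=> FB; split.
  have := finite_rv_determined (@mF n) FB true.
  by congr measurable; apply/seteqP; split=> x /= /asboolP.
by move=> e e0; exists n; rewrite cond_entropy_determined// ltW.
Qed.

Lemma approximableC B : approximable B -> approximable (~` B).
Proof.
move=> [mB aB]; split; first exact: measurableC.
move=> e /aB[n Be]; exists n.
apply: le_trans Be; apply: cond_entropy_mono => //.
  exact: finite_rv_indicator.
apply: determines_jointl => x y /indicator_rv_eq xB.
by apply/indicator_rv_eq; split=> xNB /xB.
Qed.

Lemma approximableU B C :
  approximable B -> approximable C -> approximable (B `|` C).
Proof.
move=> aB aC; have [mB _] := aB; have [mC _] := aC.
split; first exact: measurableU.
move=> e e0; have e2 : 0 < e / 2 by rewrite divr_gt0.
have [n Bn] := approximableW aB e2; have [m Cm] := approximableW aC e2.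
exists (maxn n m); apply: le_trans (cond_entropy_indicatorU mB mC (@mF _)) _.
by rewrite [e]splitr lerD// ?Bn ?Cm// ?leq_maxl ?leq_maxr.
Qed.

Lemma approximable0 : approximable set0.
Proof.
by apply: (@approximable_determined 0%N) => x y _; exact/indicator_rv_eq.
Qed.

(** A countable union is approximated in measure by its finite subunions, hence
    in conditional entropy by the triangle inequality. *)
Lemma approximable_bigcup (B : nat -> set T) :
  (forall i, approximable (B i)) -> approximable (\bigcup_i B i).
Proof.
move=> aB; have mB i : measurable (B i) by case: (aB i).
have mU : measurable (\bigcup_i B i) by exact: bigcupT_measurable.
split=> // e e0; have e2 : 0 < e / 2 by rewrite divr_gt0.
pose C n := \big[setU/set0]_(i < n) B i.
have aC n : approximable (C n).
  by apply: big_ind => //; [exact: approximable0|exact: approximableU].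
have mC n : measurable (C n) by case: (aC n).
have CB n : C n `<=` \bigcup_i B i.
  by rewrite /C -bigcup_mkord; move=> x [i _ Bx]; exists i.
have [t t0 small] := rv_entropy_indicator_small e2.
have [n Cn] : exists n, fine (mu ((\bigcup_i B i) `\` C n)) <= t.
  have : mu (C n) @[n --> \oo] --> mu (\bigcup_i B i).
    rewrite (_ : \bigcup_i B i = \bigcup_i C i); last first.
      rewrite -bigcup_bigsetU_bigcup; apply/seteqP.
      split=> [x [k _ kx]|x [k _ /CB]]; first by exists k.+1.
      by rewrite bigcup_bigsetU_bigcup.
    apply: nondecreasing_cvg_mu => //; first exact: bigcupT_measurable.
    apply/nondecreasing_seqP => k.
    by rewrite subsetEset /C big_ord_recr/=; exact: subsetUl.
  rewrite -[X in _ --> X]fineK ?fin_num_measure// => /fine_cvgP[_].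
  move=> /cvgrPdist_le/(_ _ t0)[n _ /(_ n (leqnn n))/= nt].
  exists n; rewrite measureD//; last by rewrite ltey_eq fin_num_measure.
  rewrite fineB ?fin_num_measure//; last exact: measurableI.
  rewrite setIidr//; apply: le_trans nt; exact: ler_norm.
have [m Hm] := (aC n).2 _ e2; exists m.
have mXC := finite_rv_indicator (mC n).
apply: le_trans (cond_entropy_triangle _ mXC (@mF m)) _.
  exact: finite_rv_indicator.
rewrite [e]splitr lerD//; apply: le_trans (small _ _ Cn); last first.
  exact: measurableD.
exact: cond_entropy_indicator_approx.
Qed.

Lemma approximable_sigma_algebra : sigma_algebra setT approximable.
Proof.
split; first exact: approximable0.
- by move=> B aB; rewrite setTD; exact: approximableC.
- exact: approximable_bigcup.
Qed.

(** A finite-valued map is determined by the indicators of its fibres, so its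
    conditional entropy is at most the sum of theirs. *)
Lemma cond_entropy_approximable (I : finType) (X : T -> I) (e : R) :
  finite_rv X -> (forall i, approximable (X @^-1` [set i])) -> 0 < e ->
  exists N, forall n, (N <= n)%N -> Hc X (F n) <= e.
Proof.
move=> mX aX e0.
pose c := e / #|I|.+1%:R; have c0 : 0 < c by rewrite divr_gt0.
pose X_ i := indicator_rv (X @^-1` [set i]).
have /choice[N_ N_P] i : exists N, forall n, (N <= n)%N -> Hc (X_ i) (F n) <= c.
  exact: approximableW.
exists (\max_i N_ i)%N => n Nn.
have mX_ i : finite_rv (X_ i) by exact: finite_rv_indicator.
(* the indicators of the fibres over the entries of s, padded by false *)
pose XX (s : seq I) x := [ffun i => (i \in s) && X_ i x].
have mXX s : finite_rv (XX s).
  apply: finite_rv_determined mX _ => x y e'; apply/ffunP => i.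
  by rewrite !ffunE /X_ /indicator_rv /= e'.
have XXle s : Hc (XX s) (F n) <= (size s)%:R * c.
  elim: s => [|i s IH].
    by rewrite mul0r cond_entropy_determined.
  apply: (@le_trans _ _ (Hc (joint (X_ i) (XX s)) (F n))).
    apply: cond_entropy_mono => //; first exact: finite_rv_joint.
    apply: determines_jointl => x y [xi xs]; apply/ffunP => j.
    move/ffunP/(_ j) : xs; rewrite !ffunE in_cons.
    by have [->|_] := eqVneq j i; rewrite ?xi.
  apply: le_trans (cond_entropy_joint_le _ _ _) _ => //.
  rewrite /= -add1n natrD mulrDl mul1r lerD// N_P// (leq_trans _ Nn)//.
  exact: leq_bigmax.
apply: (@le_trans _ _ (Hc (XX (enum I)) (F n))).
  apply: cond_entropy_mono => //; apply: determines_jointl => x y.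
  move=> /ffunP/(_ (X x)); rewrite !ffunE mem_enum/= => /indicator_rv_eq.
  by move=> /= [h _]; rewrite h.
apply: (le_trans (XXle _)); rewrite -cardE /c mulrA ler_pdivrMr// mulrC.
by rewrite ler_pM2l// ler_nat.
Qed.

End filtration.

End cond_entropy.

(** * Entropy of itineraries *)

Section itineraries.
Context d (T : measurableType d) (R : realType) (mu : probability T R).
Variable f : {mfun T >-> T}.
Hypothesis inv_f : invariant_measure mu f.
Local Notation H := (rv_entropy mu).
Local Notation Hc := (cond_entropy mu).

Definition itinerary (I : Type) (X : T -> I) (n : nat) (x : T) :
  {ffun 'I_n -> I} :=
  [ffun i : 'I_n => X (iter i f x)].

Lemma itineraryS_determined (I : Type) (X : T -> I) n :
  determines (joint X (itinerary X n \o f)) (itinerary X n.+1).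
Proof.
move=> x y [/= Xxy /ffunP itxy]; apply/ffunP => -[[|i] lti]; rewrite !ffunE//=.
by move: (itxy (Ordinal (lti : (i < n)%N))); rewrite !ffunE/= -!iterS !iterSr.
Qed.

Lemma itineraryS_determines_head (I : Type) (X : T -> I) n :
  determines (itinerary X n.+1) X.
Proof. by move=> x y /ffunP/(_ ord0); rewrite !ffunE. Qed.

Lemma itineraryS_determines_tail (I : Type) (X : T -> I) n :
  determines (itinerary X n.+1) (itinerary X n \o f).
Proof.
move=> x y /ffunP itxy; apply/ffunP => i; rewrite !ffunE/=.
by move: (itxy (lift ord0 i)); rewrite !ffunE/= -!iterS !iterSr.
Qed.

Lemma itinerary_mono (I : Type) (X : T -> I) m n : (m <= n)%N ->
  determines (itinerary X n) (itinerary X m).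
Proof.
move=> mn x y /ffunP itxy; apply/ffunP => i.
by move: (itxy (widen_ord mn i)); rewrite !ffunE.
Qed.

Lemma finite_rv_itinerary (I : finType) (X : T -> I) n :
  finite_rv X -> finite_rv (itinerary X n).
Proof.
move=> mX; elim: n => [|n IH].
  apply: (@finite_rv_determined _ _ _ _ _ (fun=> tt)) => [|x y _].
    exact: finite_rv_cst.
  by apply/ffunP => -[].
apply: finite_rv_determined (@itineraryS_determined _ X n).
by apply: finite_rv_joint => //; exact: finite_rv_mfun.
Qed.

Lemma itinerary_determines (I J : Type) (X : T -> I) (Y : T -> J) n :
  determines X Y -> determines (itinerary X n) (itinerary Y n).
Proof.
move=> XY x y /ffunP itxy; apply/ffunP => i.
by move: (itxy i); rewrite !ffunE => /XY.
Qed.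

(** An itinerary of length n + 1 amounts to X together with the itinerary of
    length n read after one step, and the latter has the entropy of the
    itinerary of length n by invariance. *)
Lemma itinerary_entropyS (I : finType) (X : T -> I) n : finite_rv X ->
  H (itinerary X n.+1) - H (itinerary X n) = Hc X (itinerary X n \o f).
Proof.
move=> mX; have mXn := @finite_rv_itinerary _ _ n mX.
rewrite /cond_entropy (rv_entropy_invariant inv_f)//; congr (_ - _).
apply: determines_entropy_eq.
- exact: finite_rv_itinerary.
- by apply: finite_rv_joint => //; exact: finite_rv_mfun.
- exact: itineraryS_determined.
- apply: determines_joint; first exact: itineraryS_determines_head.
  exact: itineraryS_determines_tail.
Qed.

Lemma cond_entropy_itinerary_le (I J : finType) (X : T -> I) (Z : T -> J) n :
  finite_rv X -> finite_rv Z ->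
  Hc (itinerary X n) (itinerary Z n) <= n%:R * Hc X Z.
Proof.
move=> mX mZ; elim: n => [|n IH].
  rewrite mul0r cond_entropy_determined//; first exact: finite_rv_itinerary.
  by move=> x y _; apply/ffunP => -[].
have mXn := @finite_rv_itinerary _ _ n mX.
have mZn := @finite_rv_itinerary _ _ n mZ.
have mZn1 := @finite_rv_itinerary _ _ n.+1 mZ.
have mXnf := finite_rv_mfun f mXn.
apply: (@le_trans _ _ (Hc (joint X (itinerary X n \o f)) (itinerary Z n.+1))).
  apply: cond_entropy_mono => //; first exact: finite_rv_joint.
  by apply: determines_jointl; exact: itineraryS_determined.
apply: le_trans (cond_entropy_joint_le mu mX mXnf mZn1) _.
rewrite -natr1 mulrDl mul1r addrC lerD//.
  apply: le_trans IH; rewrite -(cond_entropy_invariant inv_f mXn mZn).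
  by apply: cond_entropy_le_cond => //; exact: itineraryS_determines_tail.
by apply: cond_entropy_le_cond => //; exact: itineraryS_determines_head.
Qed.

(** After division by n: passing from Z to X raises the mean entropy of
    itineraries by at most the conditional entropy of X given Z. *)
Lemma itinerary_entropy_le (I J : finType) (X : T -> I) (Z : T -> J) n :
  finite_rv X -> finite_rv Z ->
  H (itinerary X n) <= H (itinerary Z n) + n%:R * Hc X Z.
Proof.
move=> mX mZ.
have mXn := @finite_rv_itinerary _ _ n mX.
have mZn := @finite_rv_itinerary _ _ n mZ.
rewrite addrC -lerBlDr; apply: le_trans (cond_entropy_itinerary_le n mX mZ).
rewrite lerD2r determines_entropy_le//; first exact: finite_rv_joint.
exact: determines_jointl.
Qed.

Lemma cvg_mean_increments (u : nat -> R) (l : R) :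
  (u n.+1 - u n) @[n --> \oo] --> l -> (u n / n%:R) @[n --> \oo] --> l.
Proof.
move=> ul; rewrite -(cvg_shiftS (fun n => u n / n%:R)).
have u0 : (u 0%N * harmonic n) @[n --> \oo] --> (0 : R).
  rewrite -[X in _ --> X](mulr0 (u 0%N)).
  by apply: cvgM; [exact: cvg_cst|exact: cvg_harmonic].
rewrite (_ : (fun n => _) =
    fun n => arithmetic_mean (fun n => u n.+1 - u n) n + u 0%N * harmonic n).
  by rewrite -[l]addr0; apply: cvgD => //; exact: cesaro.
apply/funext => n; rewrite /arithmetic_mean /series/= telescope_sumr//.
by rewrite [X in _ + X]mulrC -mulrDr subrK mulrC.
Qed.

(** The increments are conditional entropies given more and more of the future,
    hence nonincreasing and nonnegative; their means converge by Cesaro. *)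
Lemma itinerary_entropy_cvg (I : finType) (X : T -> I) : finite_rv X ->
  cvg ((H (itinerary X n) / n%:R) @[n --> \oo]).
Proof.
move=> mX; pose v n := Hc X (itinerary X n \o f).
have mXn n : finite_rv (itinerary X n \o f).
  exact/finite_rv_mfun/finite_rv_itinerary.
have v_cvg : cvgn v.
  apply: nonincreasing_is_cvgn.
    apply/nonincreasing_seqP => n; apply: cond_entropy_le_cond => //.
    by move=> x y /= /(itinerary_mono (leqnSn n)).
  by exists 0 => _ [n _ <-]; exact: cond_entropy_ge0.
apply/cvg_ex; exists (limn v); apply: cvg_mean_increments.
by under eq_fun do rewrite itinerary_entropyS//.
Qed.

Section partition_rv.
Variables (k : nat) (P : 'I_k -> set T).
Hypothesis mP : measurable_partition P.

Lemma partition_rv : exists2 X : T -> 'I_k, finite_rv X &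
  forall i, X @^-1` [set i] = P i.
Proof.
have [mPi [covP /trivIsetP tP _]] := mP.
have /choice[X XP] x : exists i, P i x.
  by have : setT x by []; rewrite -covP => -[i _ Pi]; exists i.
have XE i : X @^-1` [set i] = P i.
  apply/seteqP; split=> [x /= <-//|x Pix /=].
  apply: contrapT => /eqP Xi; have : (P (X x) `&` P i) x by split.
  by rewrite tP.
by exists X => // i; rewrite XE.
Qed.

Lemma itinerary_entropyE (X : T -> 'I_k) n :
  (forall i, X @^-1` [set i] = P i) ->
  itinerary_entropy mu f P n = H (itinerary X n).
Proof.
move=> XP; rewrite /itinerary_entropy -sumrN; apply: eq_bigr => w _.
rewrite /neg_xlog /mass.
suff -> : itinerary_cell f P w = itinerary X n @^-1` [set w] by [].
apply/seteqP; split=> x /= => [xw|xw i].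
  by apply/ffunP => i; rewrite ffunE; move: (xw i); rewrite -XP.
by rewrite -XP/= -xw ffunE.
Qed.

End partition_rv.

End itineraries.

(** * The space of configurations *)

Section configurations.
Variable A : finPointedType.
Local Notation X := (borel_config A).

Definition letter (z : int) (a : X) : A := a z.

Definition window (z : int) (n : nat) (a : X) : {ffun 'I_n -> A} :=
  [ffun i : 'I_n => a (z + i%:Z)].

(** Windows that grow by one letter at a time, alternately on both sides, so
    that they have length n and exhaust the integers. *)
Definition central_window (n : nat) : X -> {ffun 'I_n -> A} :=
  window (- (n./2)%:Z) n.

Lemma window_eqP z n (a b : X) : window z n a = window z n b <->
  forall k, (k < n)%N -> a (z + k%:Z) = b (z + k%:Z).
Proof.
split=> [/ffunP ab k kn|ab].
  by have := ab (Ordinal kn); rewrite !ffunE.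
by apply/ffunP => i; rewrite !ffunE; exact: ab.
Qed.

Lemma window_le z n z' n' : z <= z' -> z' + n'%:Z <= z + n%:Z ->
  determines (window z n) (window z' n').
Proof.
move=> zz' nn' a b /window_eqP ab; apply/window_eqP => k kn.
have -> : z' + k%:Z = z + (absz (z' - z) + k)%N%:Z by lia.
by apply: ab; lia.
Qed.

Lemma central_window_le m n :
  (m <= n)%N -> determines (central_window n) (central_window m).
Proof. by move=> mn; apply: window_le; lia. Qed.

Lemma measurable_letter z (w : A) : measurable (letter z @^-1` [set w] : set X).
Proof.
apply: sub_sigma_algebra; rewrite openE => a /= aw; rewrite /interior.
have := @proj_continuous _ (fun=> discrete_topology A) z a.
by move=> /(_ _ (discrete_set1 (a z : discrete_topology A))); rewrite -aw.
Qed.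

Lemma finite_rv_letter z : finite_rv (letter z).
Proof. exact: measurable_letter. Qed.

Lemma finite_rv_window z n : finite_rv (window z n).
Proof.
move=> w; rewrite [Y in measurable Y](_ : _ =
    \bigcap_(i in [set: 'I_n]) letter (z + i%:Z) @^-1` [set w i]).
  by apply: fin_bigcap_measurable => // i _; exact: measurable_letter.
apply/seteqP; split=> [a <- i _ /=|a aw /=]; first by rewrite ffunE.
by apply/ffunP => i; rewrite ffunE; exact: aw.
Qed.

(** The sets containing some cylinder around a form a filter, which converges
    to a in each coordinate and therefore in the product topology. *)
Lemma nbhs_config (a : config A) (U : set (config A)) : nbhs a U ->
  exists n, forall b : config A, central_window n a = central_window n b -> U b.
Proof.
pose F : set_system (config A) := [set V | exists n, forall b : config A,
  central_window n a = central_window n b -> V b].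
have FF : Filter F.
  split.
  - by exists 0%N.
  - move=> P Q [m mP] [n nQ]; exists (maxn m n) => b ab; split.
      by apply: mP; apply: central_window_le ab; rewrite leq_maxl.
    by apply: nQ; apply: central_window_le ab; rewrite leq_maxr.
  - by move=> P Q PQ [n nP]; exists n => b /nP/PQ.
have /(_ U) : F --> a.
  have hP := @cvg_sup (int -> A) int (fun k => Topological.class
    (initial_topology (fun b : int -> discrete_topology A => b k))) F a.
  apply: (snd (hP FF)) => z V [_ [[W _ <-] Wa] /filterS]; apply.
  (* the window of length 2 k starts at - k and ends before k *)
  exists (2 * (absz z).+1)%N => b /window_eqP/(_ (absz (z + (absz z).+1)))/=.
  rewrite (_ : - _ + _ = z); last by lia.
  by move=> <-//; lia.
by apply.
Qed.

(** It suffices to treat open sets, and an open set O is the increasing union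
    over n of the sets of points whose n-th cylinder lies in O. *)
Lemma borel_config_ind (G : set (set X)) : sigma_algebra setT G ->
  (forall n B, determines (central_window n) (indicator_rv B) -> G B) ->
  forall B, measurable B -> G B.
Proof.
move=> sG winG; apply: smallest_sub => // O oO.
pose O_ n : set X := [set a | forall b : X,
  central_window n a = central_window n b -> O b].
rewrite (_ : O = \bigcup_n O_ n).
  case: sG => _ _; apply=> n; apply: (winG n) => a b ab.
  by apply/indicator_rv_eq; rewrite /O_/= ab.
apply/seteqP; split=> [a Oa|a [n _]]; last exact.
have [n nO] := nbhs_config (open_nbhs_nbhs (conj oO Oa)).
by exists n.
Qed.

End configurations.

(** * Quasigroup automata and windows *)

Section quasigroup_automaton.
Variables (A : finPointedType) (op : A -> A -> A).
Hypothesis opQ : quasigroup_law op.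
Local Notation X := (borel_config A).
Local Notation Phi := (quasigroup_ca op).
Local Notation sigma := (@config_shift A).

Lemma ca_window z n : determines (@window A z n.+1) (window z n \o Phi).
Proof.
move=> a b /window_eqP ab; apply/window_eqP => k kn.
rewrite /quasigroup_ca -addrA -PoszD addn1.
by congr op; apply: ab; lia.
Qed.

(** Knowing a at 0 and Phi a on the window, one solves for the letters of a to
    the right by left cancellation and to the left by right cancellation. *)
Lemma window_ca (m n : nat) : (m <= n)%N ->
  determines (joint (letter 0) (window (- m%:Z) n \o Phi))
    (@window A (- m%:Z) n.+1).
Proof.
have [rop lop] := opQ.
move=> mn a b [/= ab0 /window_eqP ab].
have right k : (m + k <= n)%N -> a k%:Z = b k%:Z.
  elim: k => // k IH mk; have := ab (m + k)%N; rewrite PoszD addKr.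
  have akb := IH ltac:(lia).
  rewrite /quasigroup_ca akb (_ : k%:Z + 1 = k.+1); last by lia.
  by move=> /(_ ltac:(lia))/rop.
have left k : (k <= m)%N -> a (- k%:Z) = b (- k%:Z).
  elim: k => // k IH mk; have := ab (m - k.+1)%N.
  rewrite (_ : - m%:Z + (m - k.+1)%N = - k.+1%:Z); last by lia.
  have akb := IH ltac:(lia).
  rewrite /quasigroup_ca (_ : - k.+1%:Z + 1 = - k%:Z); last by lia.
  by rewrite akb => /(_ ltac:(lia))/lop.
apply/window_eqP => k kn; have [mk|km] := leqP m k.
  rewrite (_ : - m%:Z + k%:Z = (k - m)%N); last by lia.
  by apply: right; lia.
rewrite (_ : - m%:Z + k%:Z = - (m - k)%N%:Z); last by lia.
by apply: left; lia.
Qed.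

Lemma ca_fiber_inj (a b : X) : Phi a = Phi b -> a 0 = b 0 -> a = b.
Proof.
move=> Pab ab0; apply/funext => z; pose m := absz z.
have /window_eqP/(_ (absz (z + m))) :
    window (- m%:Z) (2 * m).+1 a = window (- m%:Z) (2 * m).+1 b.
  by apply: window_ca; [lia|rewrite /joint/= Pab /letter ab0].
by rewrite (_ : - m%:Z + _ = z); [apply; lia|lia].
Qed.

(** An injective translation of a finite alphabet is onto, so the equations
    defining a preimage can be solved step by step from the letter at 0. *)
Lemma ca_fiber_surj (u : X) (w : A) : exists2 a : X, Phi a = u & a 0 = w.
Proof.
have [rop lop] := opQ.
(* r n is the letter at n and l n the letter at - n *)
pose r := fix r n := if n is k.+1 then invF (rop (r k)) (u k%:Z) else w.
pose l := fix l n := if n is k.+1 then invF (lop (l k)) (u (- k.+1%:Z)) else w.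
exists (fun z => match z with Posz n => r n | Negz n => l n.+1 end) => //.
apply/funext => -[n|n]; rewrite /quasigroup_ca.
  by rewrite -PoszD addn1 /= f_invF.
case: n => [|n].
  by rewrite /= (f_invF (lop w)).
rewrite (_ : Negz n.+1 + 1 = Negz n); last by lia.
by rewrite [LHS](f_invF (lop (l n.+1))).
Qed.

Lemma ca_shift (a : X) : Phi (sigma a) = sigma (Phi a).
Proof. by apply/funext => z; rewrite /quasigroup_ca /config_shift addrAC. Qed.

(** The letters at 0 of a, Phi a, .., Phi^(n-1) a suffice: by induction they
    give Phi a on the first n - 1 places, and then a by solving from the letter
    at 0. *)
Lemma itinerary_window n :
  determines (itinerary Phi (letter 0) n) (@window A 0 n).
Proof.
elim: n => [|n IH] a b; first by move=> _; apply/window_eqP.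
move=> ab; rewrite -oppr0; apply: (@window_ca 0 n) => //; congr pair.
  exact: itineraryS_determines_head ab.
rewrite oppr0; apply: IH; exact: itineraryS_determines_tail ab.
Qed.

Lemma window_itinerary_letter n :
  determines (@window A 0 n) (itinerary Phi (letter 0) n).
Proof.
elim: n => [|n IH] a b; first by move=> _; apply/ffunP => -[].
move=> ab; apply: itineraryS_determined; congr pair.
  by move/window_eqP/(_ 0%N isT) : ab; rewrite addr0.
by apply: IH; exact: ca_window ab.
Qed.

(** Each iteration looks one letter ahead. The length k + n is larger than
    needed, which spares a case distinction at n = 0. *)
Lemma window_itinerary_window z k n :
  determines (@window A z (k + n)) (itinerary Phi (window z k) n).
Proof.
elim: n => [|n IH] a b; first by move=> _; apply/ffunP => -[].
move=> ab; apply: itineraryS_determined; congr pair.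
  by apply: window_le ab; lia.
by apply: IH; apply: ca_window; rewrite -addnS.
Qed.

Section entropy_windows.
Context {R : realType} (mu : probability X R).
Hypothesis inv_sigma : invariant_measure mu sigma.

Definition block_entropy n : R := rv_entropy mu (@window A 0 n).

Lemma window_entropy (m n : nat) :
  rv_entropy mu (@window A (- m%:Z) n) = block_entropy n.
Proof.
elim: m => [|m <-]; first by rewrite oppr0.
rewrite -[RHS](rv_entropy_invariant inv_sigma (@finite_rv_window A _ _)).
congr rv_entropy; apply/funext => a; apply/ffunP => i.
by rewrite !ffunE /config_shift; congr a; lia.
Qed.

Hypothesis inv_Phi : invariant_measure mu Phi.

(** A block of n + 1 letters around 0 amounts to the letter at 0 and n letters
    of Phi a, and the latter have the entropy of n letters of a. *)
Lemma block_entropyS (m n : nat) : (m <= n)%N ->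
  block_entropy n.+1 - block_entropy n =
  cond_entropy mu (@letter A 0) (window (- m%:Z) n \o Phi).
Proof.
move=> mn; have mW := @finite_rv_window A (- m%:Z) n.
rewrite /cond_entropy (rv_entropy_invariant inv_Phi mW) -!(window_entropy m).
congr (_ - _); apply: determines_entropy_eq.
- exact: finite_rv_window.
- by apply: finite_rv_joint; [exact: finite_rv_letter|exact: finite_rv_mfun].
- exact: window_ca.
- apply: determines_joint; last exact: ca_window.
  move=> a b /window_eqP/(_ m); rewrite addNr; apply; lia.
Qed.

End entropy_windows.

End quasigroup_automaton.

(** * Almost invariant sets and functions of an ergodic map *)

Section zero_one_law.
Context d (T : measurableType d) (R : realType) (mu : probability T R).
Variable f : {mfun T >-> T}.

Lemma measurable_mfun_preimage B : measurable B -> measurable (f @^-1` B).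
Proof.
by move=> mB; rewrite -[X in measurable X]setTI; exact: measurable_funPT.
Qed.

Lemma measurable_iter_preimage n B :
  measurable B -> measurable (iter n f @^-1` B).
Proof.
move=> mB; elim: n => // n IH.
rewrite (_ : _ @^-1` _ = f @^-1` (iter n f @^-1` B)).
  exact: measurable_mfun_preimage.
by apply/seteqP; split=> x; rewrite /= -iterS iterSr.
Qed.

Lemma invariant_negligible B : invariant_measure mu f ->
  mu.-negligible B -> mu.-negligible (f @^-1` B).
Proof.
move=> inv [C [mC C0 BC]]; exists (f @^-1` C); split.
- exact: measurable_mfun_preimage.
- by rewrite inv.
- by move=> x /BC.
Qed.

Lemma measure_ae_eq B C : measurable B -> measurable C ->
  {ae mu, forall x, B x <-> C x} -> mu B = mu C.
Proof.
have le B' C' : measurable B' -> measurable C' ->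
    {ae mu, forall x, B' x <-> C' x} -> (mu B' <= mu C')%E.
  move=> mB mC [N [mN N0 BCN]]; rewrite -[leRHS]adde0 -N0.
  apply: le_trans (measureU2 mu mC mN); apply: le_measure; rewrite ?inE//.
    exact: measurableU.
  move=> x Bx; have [Cx|NCx] := pselect (C' x); [by left|right].
  by apply: BCN => /= -[/(_ Bx)].
move=> mB mC ae; apply/eqP; rewrite eq_le !le//.
by apply: filterS ae => x [].
Qed.

(** Ergodicity is about strictly invariant sets; the set of points that visit B
    infinitely often is one, and agrees with B almost everywhere. *)
Lemma ergodic_almost_invariant B : ergodic_measure mu f -> measurable B ->
  {ae mu, forall x, B x <-> B (f x)} -> mu B = 0%E \/ mu B = 1%E.
Proof.
move=> [inv erg] mB aeB.
pose C : set T := \bigcap_n \bigcup_k (iter (n + k) f @^-1` B).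
have mC : measurable C.
  apply: bigcapT_measurable => n; apply: bigcupT_measurable => k.
  exact: measurable_iter_preimage.
have fC : f @^-1` C = C.
  apply/seteqP; split=> x Cx n _.
    have [k _ /= kB] := Cx n I; exists k.+1 => //=.
    by rewrite addnS iterSr.
  have [k _ /= kB] := Cx n.+1 I; exists k => //=.
  by rewrite -iterSr.
rewrite (@measure_ae_eq B C)//; first exact: erg.
have aen n : {ae mu, forall x, B (iter n f x) <-> B (iter n.+1 f x)}.
  elim: n => // n; rewrite /almost_everywhere.
  move=> /(invariant_negligible inv); apply: negligibleS => x /= h xB; apply: h.
  by rewrite -!iterS !iterSr in xB *.
have /= := ae_foralln aen; apply: filterS => x xB.
have Bk k : B x <-> B (iter k f x).
  by elim: k => // k IH; rewrite IH; exact: xB.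
split=> [Bx n _|/(_ 0%N I)[k _ /=]]; last by rewrite add0n -Bk.
by exists 0%N => //=; rewrite addn0 -Bk.
Qed.

End zero_one_law.

Section almost_invariant_function.
Context d (T : measurableType d) (R : realType) (mu : probability T R).
Variable f : {mfun T >-> T}.

Lemma probability_not_negligible : ~ mu.-negligible [set: T].
Proof.
move=> /(negligibleP _ measurableT).1 T0; have : (1 : \bar R)%E = 0%E.
  by rewrite -[RHS]T0; exact/esym/probability_setT.
by move=> /eqP; rewrite onee_eq0.
Qed.

(** All sublevel sets have measure 0 or 1; the constant is the supremum of the
    levels whose sublevel set is null. *)
Lemma ergodic_ae_constant (h : T -> R) : ergodic_measure mu f ->
  (forall t, measurable [set x | h x < t]) -> (forall x, 0 <= h x) ->
  {ae mu, forall x, h (f x) = h x} ->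
  exists c, {ae mu, forall x, h x = c}.
Proof.
move=> erg mh h0 hf.
pose E t : set T := [set x | h x < t].
have E01 t : mu (E t) = 0%E \/ mu (E t) = 1%E.
  apply: (ergodic_almost_invariant erg); first exact: mh.
  by apply: (filterS _ hf) => x hx; rewrite /E/= hx.
have Emono s t : s <= t -> (mu (E s) <= mu (E t))%E.
  move=> st; apply: le_measure; rewrite ?inE//; try exact: mh.
  by move=> x /= /lt_le_trans; apply.
pose S := [set t | mu (E t) = 0%E].
have S0 : S 0.
  rewrite /S/= (_ : E 0 = set0) ?measure0//; apply/seteqP; split=> // x.
  by rewrite /E/= ltNge h0.
have [n En] : exists n : nat, mu (E n%:R) = 1%E.
  apply/not_existsP => nE.
  have : mu.-negligible (\bigcup_n E n%:R).
    apply: negligible_bigcup => n; apply/negligibleP; first exact: mh.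
    by case: (E01 n%:R) => // /nE.
  rewrite (_ : \bigcup_n _ = setT).
    exact: probability_not_negligible.
  apply/seteqP; split=> // x _; exists (Num.truncn (h x)).+1 => //.
  by rewrite /E/= truncnS_gt.
have Sub : has_sup S.
  split; first by exists 0.
  exists n%:R => t St; rewrite leNgt; apply/negP => /ltW/Emono.
  by rewrite En St leNgt lte01.
pose c := sup S; exists c.
have below k : mu.-negligible (E (c - k.+1%:R^-1)).
  apply/negligibleP; first exact: mh.
  have /(sup_adherent)/(_ Sub) [t St ct] : 0 < k.+1%:R^-1 :> R by [].
  by apply/eqP; rewrite eq_le measure_ge0 andbT -[leRHS]St Emono// ltW.
have above k : mu.-negligible (~` E (c + k.+1%:R^-1)).
  apply/negligibleP; first exact/measurableC/mh.
  case: (E01 (c + k.+1%:R^-1)) => [SE|E1].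
    have /(ub_le_sup Sub.2) : S (c + k.+1%:R^-1) by [].
    by rewrite -/c gerDl leNgt invr_gt0 ltr0Sn.
  transitivity (1 - mu (E (c + k.+1%:R^-1)%R))%E; last by rewrite E1 subee.
  exact/probability_setC/mh.
have := negligibleU (negligible_bigcup below) (negligible_bigcup above).
apply: negligibleS => x /= /eqP; rewrite neq_lt => /orP[hc|hc].
  left; exists (Num.truncn (c - h x)^-1) => //; rewrite /E/= ltrBrDr -ltrBrDl.
  rewrite invf_plt ?posrE ?subr_gt0 ?truncnS_gt//.
right; exists (Num.truncn (h x - c)^-1) => //; rewrite /E/=; apply/negP.
rewrite -leNgt -lerBrDl invf_ple ?posrE ?subr_gt0// ltW// truncnS_gt//.
Qed.

End almost_invariant_function.

(** * Radon-Nikodym densities along a map *)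

Section fiber_density.
Context d (T : measurableType d) (R : realType) (mu : probability T R).
Variables (f : {mfun T >-> T}) (D : set T) (mD : measurable D).
Local Open Scope ereal_scope.

Let fiber_measure : set T -> \bar R := pushforward (mrestr mu mD) f.

Let fiber_measure_sigma_additive : semi_sigma_additive fiber_measure.
Proof.
have mf := @measurable_funPT _ _ _ _ f.
exact: (@measure_semi_sigma_additive _ _ _ (pushforward (mrestr mu mD) f)).
Qed.

Let fiber_measure0 : fiber_measure set0 = 0.
Proof. by rewrite /fiber_measure /pushforward preimage_set0 measure0. Qed.

Let fiber_measure_ge0 B : 0 <= fiber_measure B.
Proof. exact: measure_ge0. Qed.

HB.instance Definition _ := isMeasure.Build _ _ _
  fiber_measure fiber_measure0 fiber_measure_ge0 fiber_measure_sigma_additive.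

Let fiber_measure_fin : fin_num_fun fiber_measure.
Proof.
by move=> B mB; apply: fin_num_measure; exact: measurable_mfun_preimage.
Qed.

HB.instance Definition _ :=
  @Measure_isFinite.Build _ _ _ fiber_measure fiber_measure_fin.

(** For the sets D that cut each fibre of f in one point, g is the conditional
    probability of that point in its fibre. It is obtained as the Radon-Nikodym
    derivative of the image by f of mu restricted to D. *)
Lemma fiber_density : invariant_measure mu f -> exists g : T -> \bar R,
  [/\ forall x, 0 <= g x, forall x, g x \is a fin_num,
      mu.-integrable setT g &
      forall B, measurable B -> mu (f @^-1` B `&` D) = \int[mu]_(x in B) g x].
Proof.
move=> inv; apply: (@radon_nikodym_sigma_finite _ _ _ mu fiber_measure).
apply/null_content_dominatesP => B mB muB0; apply/eqP.
rewrite eq_le measure_ge0 andbT -[leRHS]muB0 -[leRHS](inv _ mB).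
have mfB := measurable_mfun_preimage f mB.
by apply: le_measure; rewrite ?inE//; exact: measurableI.
Qed.

End fiber_density.

(** * Densities of the fibres of the automaton *)

Section fiber_structure.
Variables (A : finPointedType) (op : A -> A -> A).
Hypothesis opQ : quasigroup_law op.
Local Notation X := (borel_config A).
Local Notation Phi := (quasigroup_ca op).
Local Notation sigma := (@config_shift A).
Context {R : realType} (mu : probability X R).

Definition config_unshift (a : X) : X := fun z => a (z + 1).

Lemma config_shiftK : cancel sigma config_unshift.
Proof.
by move=> a; apply/funext => z; rewrite /config_shift/config_unshift addrK.
Qed.

Lemma measurable_unshift (B : set X) :
  measurable B -> measurable (config_unshift @^-1` B).
Proof.
move: B; apply: borel_config_ind => [|n B winB].
  split; first by rewrite preimage_set0.
  - by move=> B mB; rewrite setTD preimage_setC; exact: measurableC.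
  - by move=> B mB; rewrite preimage_bigcup; exact: bigcupT_measurable.
have := @finite_rv_determined _ X _ _ (indicator_rv (config_unshift @^-1` B))
  (window (- n./2%:Z + 1) n) (@finite_rv_window _ _ _).
have det : determines (@window A (- n./2%:Z + 1) n)
    (indicator_rv (config_unshift @^-1` B)).
  move=> a b /window_eqP ab; apply/indicator_rv_eq => /=.
  apply/indicator_rv_eq/winB/window_eqP => k kn.
  by rewrite /config_unshift addrAC ab.
move=> /(_ det true); congr measurable.
by apply/seteqP; split=> x /= /asboolP.
Qed.

Section density.
Hypothesis inv_sigma : invariant_measure mu sigma.
Variable g : A -> X -> \bar R.
Hypothesis g_ge0 : forall w b, (0 <= g w b)%E.
Hypothesis g_int : forall w, mu.-integrable setT (g w).
Hypothesis gE : forall w B, measurable B ->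
  mu (Phi @^-1` B `&` letter 0 @^-1` [set w]) = (\int[mu]_(b in B) g w b)%E.

(** For b with letter v * w at -1, the preimage of b with letter w at 0 is the
    one with letter v at -1, whose shift is the preimage of sigma b with letter
    v at 0. So both sides are the conditional probability of the same point;
    the proof compares their integrals over all sets of such b. *)
Lemma density_cocycle v w :
  ae_eq mu (letter (-1) @^-1` [set op v w]) (g w) (g v \o sigma).
Proof.
have [rop lop] := opQ.
have mg u : measurable_fun setT (g u) by exact: measurable_int (g_int u).
have mC : measurable (letter (-1) @^-1` [set op v w] : set X).
  exact: measurable_letter.
apply: integral_ae_eq => //; first exact: integrableS (g_int w).
  by apply: measurable_funTS; apply: measurableT_comp.
move=> E EC mE; have mtE := measurable_unshift mE.
have EtE : E = sigma @^-1` (config_unshift @^-1` E).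
  by apply/seteqP; split=> a /=; rewrite config_shiftK.
rewrite -gE// [in RHS]EtE -ge0_integral_pushforward//; last first.
  exact: measurable_funTS.
rewrite (eq_measure_integral mu); last by move=> B mB _; exact: inv_sigma.
rewrite -gE// -[RHS]inv_sigma; last first.
  apply: measurableI; first exact: measurable_mfun_preimage.
  exact: measurable_letter.
congr (mu _); apply/seteqP; split=> a /=.
- move=> [Ea aw]; rewrite ca_shift config_shiftK; split=> //.
  apply: (lop w); have /= := EC _ Ea.
  by rewrite /letter /quasigroup_ca addNr -aw.
- rewrite ca_shift config_shiftK => -[Ea av]; split=> //.
  apply: (rop v); have /= := EC _ Ea.
  by rewrite /letter /quasigroup_ca addNr -av.
Qed.

End density.

Hypothesis inv_Phi : invariant_measure mu Phi.
Hypothesis erg_sigma : ergodic_measure mu sigma.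

Lemma ae_ca (P : set X) :
  {ae mu, forall b, P b} -> {ae mu, forall a, P (Phi a)}.
Proof. exact: invariant_negligible. Qed.

Lemma fiber_measure_sum (B : set X) : measurable B ->
  (\sum_w mu (Phi @^-1` B `&` letter 0 @^-1` [set w]) = mu B)%E.
Proof.
move=> mB; rewrite -(inv_Phi mB).
have mPB : measurable (Phi @^-1` B) by exact: measurable_mfun_preimage.
have mI w : measurable (Phi @^-1` B `&` letter 0 @^-1` [set w]).
  by apply: measurableI => //; exact: measurable_letter.
rewrite -[RHS]fineK ?fin_num_measure//.
rewrite (measure_split mu (@finite_rv_letter A 0) mPB).
rewrite -sumEFin; apply: eq_bigr => w _.
by rewrite fineK ?fin_num_measure//.
Qed.

(** The conditional probability h a of a in its own fibre is invariant under
    the shift by the cocycle relation, hence equal to a constant c. The set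
    where g w differs from c is then null for the measure of density g w, so
    that g w vanishes there. *)
Lemma uniform_density : exists (c : R) (g : A -> X -> R),
  [/\ forall w, measurable_fun [set: X] (g w),
      forall w B, measurable B ->
        mu (Phi @^-1` B `&` letter 0 @^-1` [set w]) =
        (\int[mu]_(b in B) (g w b)%:E)%E,
      {ae mu, forall b, \sum_w g w b = 1} &
      {ae mu, forall b, forall w, g w b = 0 \/ g w b = c}].
Proof.
have [inv_sigma _] := erg_sigma.
have /choice[G GP] w := fiber_density (@measurable_letter A 0 w) inv_Phi.
have G0 w b : (0 <= G w b)%E by case: (GP w).
have Gfin w b : G w b \is a fin_num by case: (GP w).
have Gint w : mu.-integrable setT (G w) by case: (GP w).
have GE w B (mB : measurable B) : mu (Phi @^-1` B `&` letter 0 @^-1` [set w]) =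
  (\int[mu]_(b in B) G w b)%E by case: (GP w) => _ _ _; apply.
have mG w : measurable_fun setT (G w) by exact: measurable_int (Gint w).
pose g w b := fine (G w b).
have gK w b : (g w b)%:E = G w b by rewrite fineK.
have mg w : measurable_fun [set: X] (g w) by exact: measurableT_comp.
have g0 w b : 0 <= g w b by rewrite fine_ge0.
have gE w B : measurable B -> mu (Phi @^-1` B `&` letter 0 @^-1` [set w]) =
    (\int[mu]_(b in B) (g w b)%:E)%E.
  by move=> mB; rewrite GE//; apply: eq_integral => b _; rewrite gK.
pose h (a : X) := g (a 0) (Phi a).
have mh B : measurable B -> measurable [set a | B (h a)].
  move=> mB; rewrite [Y in measurable Y](_ : _ = \bigcup_(w in [set: A])
      (letter 0 @^-1` [set w] `&` Phi @^-1` (g w @^-1` B))).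
    apply: fin_bigcup_measurable => [|w _]; first exact: finite_finset.
    apply: measurableI; first exact: measurable_letter.
    apply: measurable_mfun_preimage; rewrite -[Y in measurable Y]setTI.
    exact: mg.
  apply/seteqP; split=> [a Ba|a [w _ [/= <-//]]].
  by exists (a 0).
have h_sigma : {ae mu, forall a, h (sigma a) = h a}.
  have /ae_ca : {ae mu, forall b : X, forall w v : A,
      b (-1) = op v w -> G w b = G v (sigma b)}.
    apply: filter_forall => w; apply: filter_forall => v.
    exact: (density_cocycle inv_sigma G0 Gint GE).
  apply: filterS => a /(_ (a 0) (a (-1))).
  rewrite {1}/quasigroup_ca addNr => /(_ erefl) e.
  by rewrite /h ca_shift /g e.
have [c hc] : exists c, {ae mu, forall a, h a = c}.
  apply: (ergodic_ae_constant erg_sigma) => // [t|a].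
    exact: (mh `]-oo, t[%classic (measurable_itv _)).
  exact: g0.
exists c, g; split=> //.
  have : ae_eq mu setT (fun b => \sum_w G w b)%E (cst 1%E).
    apply: integral_ae_eq => //.
    - by apply: integrable_sum => // w _.
    - move=> B _ mB; rewrite ge0_integral_sum//.
        under eq_bigr do rewrite -GE//.
        by rewrite fiber_measure_sum// integral_cst// mul1e.
      by move=> w; exact: measurable_funTS.
  apply: filterS => b /(_ I); under eq_bigr do rewrite -gK.
  by rewrite sumEFin => -[].
apply: filter_forall => w.
have mM : measurable (~` (g w @^-1` [set c])).
  apply: measurableC; rewrite -[Y in measurable Y]setTI.
  exact: mg.
have : (\int[mu]_(b in ~` (g w @^-1` [set c])) `|G w b|)%E = 0%E.
  under eq_integral do rewrite gee0_abs//.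
  rewrite -GE//; apply: measure_negligible.
    apply: measurableI; last exact: measurable_letter.
    exact: measurable_mfun_preimage.
  apply: negligibleS hc => a [/= gc aw]; apply: contra_not gc.
  by rewrite /h -[a 0]/(letter 0 a) aw.
move/(ae_eq_integral_abs mu mM); move=> /(_ (measurable_funTS (mG w))).
apply: filterS => b /= gb.
have [->|/eqP gc] := eqVneq (g w b) c; first by right.
by left; rewrite /g (gb gc).
Qed.

End fiber_structure.

(** * Uniform fibres *)

Section fiber_letters.
Variables (A : finPointedType) (op : A -> A -> A).
Hypothesis opQ : quasigroup_law op.
Local Notation X := (borel_config A).
Local Notation Phi := (quasigroup_ca op).
Local Notation sigma := (@config_shift A).
Context {R : realType} (mu : probability X R).
Hypothesis inv_Phi : invariant_measure mu Phi.

(** Given Phi a = b, the letter of a at 0 is uniformly distributed on q b,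
    which has K elements: the densities of its conditional law are indicators
    divided by K. *)
Definition uniform_fibers (K : nat) (q : X -> {set A}) : Prop :=
  [/\ finite_rv q, forall b, #|q b| = K &
      forall w B, measurable B ->
        mu (Phi @^-1` B `&` letter 0 @^-1` [set w]) =
        ((K%:R^-1 : R)%:E * mu (B `&` [set b | w \in q b]))%E].

(** Where the densities sum to 1 and take only the values 0 and c, the number
    of letters of density c is 1 / c. On the remaining null set, q is given the
    value at a fixed good point, so that the cardinality is K everywhere. *)
Lemma uniform_fibers_exist : ergodic_measure mu sigma ->
  exists K q, uniform_fibers K q.
Proof.
move=> erg; have [c [g [mg gE gsum gc]]] := uniform_density opQ inv_Phi erg.
pose q0 (b : X) : {set A} := finset (fun w => g w b == c).
have mgc w : measurable (g w @^-1` [set c] : set X).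
  by rewrite -[Y in measurable Y]setTI; exact: mg.
have mq0 : finite_rv q0.
  move=> S; rewrite [Y in measurable Y](_ : _ = \bigcap_(w in [set: A])
    (if w \in S then g w @^-1` [set c] else ~` (g w @^-1` [set c]))).
    apply: fin_bigcap_measurable => [|w _]; first exact: finite_finset.
    by case: ifP => _; [exact: mgc|apply: measurableC; exact: mgc].
  apply/seteqP; split=> [b <- w _|b bS]; rewrite /q0/=.
    by rewrite inE; case: eqP.
  apply/setP => w; rewrite inE; have := bS w I.
  by case: ifP => _ /=; [move/eqP|move/eqP/negbTE].
have good : {ae mu, forall b, #|q0 b|%:R * c = 1 /\
    forall w, g w b = c * (w \in q0 b)%:R}.
  apply: filterS2 gsum gc => b gs gw.
  have gE' w : g w b = c * (w \in q0 b)%:R.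
    by rewrite inE; have [->|gcN] := eqVneq (g w b) c;
      rewrite ?mulr1// mulr0; case: (gw w) => // /eqP; rewrite (negbTE gcN).
  split=> //; apply: etrans gs; under [RHS]eq_bigr do rewrite gE'.
  rewrite -mulr_sumr mulrC -natr_sum -sum1_card big_mkcond /=.
  by congr (_ * _%:R); apply: eq_bigr => w _; case: ifP.
have [b0 [b0c _]] : exists b0, #|q0 b0|%:R * c = 1 /\
    forall w, g w b0 = c * (w \in q0 b0)%:R.
  apply/not_existsP => nb; apply: (@probability_not_negligible _ _ _ mu).
  by apply: negligibleS good => b _ /=; exact: nb.
pose K := #|q0 b0|; have K0 : (0 < K)%N.
  by rewrite lt0n; apply/eqP => K0; move: b0c; rewrite -/K K0 mul0r => /eqP;
    rewrite eq_sym oner_eq0.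
have KN : K%:R != 0 :> R by rewrite pnatr_eq0 -lt0n.
have cK : c = K%:R^-1 by rewrite -[LHS](mulKf KN) b0c mulr1.
pose q b := if #|q0 b| == K then q0 b else q0 b0.
have mq : finite_rv q.
  by apply: finite_rv_determined mq0 _ => a b ab; rewrite /q ab.
exists K, q; split=> // [b|w B mB].
  by rewrite /q; case: eqP.
pose S : set X := [set b | w \in q b].
have mS : measurable S.
  exact: (finite_rv_preimage [set V : {set A} | w \in V] mq).
have c0 : 0 <= c by rewrite cK invr_ge0.
rewrite gE// (@ae_eq_integral _ _ _ mu B (fun b => c%:E * (\1_S b)%:E)%E)//.
- rewrite ge0_integralZl//; first by rewrite integral_indic// cK setIC.
  by apply: measurable_funTS; exact/measurable_EFinP/measurable_indic.
- by apply: measurable_funTS; exact/measurable_EFinP.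
- apply: measurable_funTS; apply: measurable_funeM.
  exact/measurable_EFinP/measurable_indic.
apply: filterS good => b [bK gb] _; rewrite gb -EFinM indicE; congr (_ * _)%:E.
suff -> : q0 b = q b by rewrite [in RHS]mem_setE.
rewrite /q; case: eqP => // /eqP bKN; exfalso; move/negP: bKN; apply.
by rewrite -(@eqr_nat R) -(inj_eq (mulIf (_ : c != 0))) ?bK ?b0c// cK invr_eq0.
Qed.

Section uniform_fibers_theory.
Variables (K : nat) (q : X -> {set A}).
Hypothesis Kq : uniform_fibers K q.

Lemma uniform_fibers_gt0 : (0 < K)%N.
Proof.
have [_ _ qE] := Kq.
case: K qE => // qE; exfalso.
apply: (@probability_not_negligible _ _ _ mu); apply/negligibleP => //.
apply: (eq_trans (esym (fiber_measure_sum inv_Phi measurableT))).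
rewrite big1// => w _.
by rewrite qE// invr0 mul0e.
Qed.

Lemma uniform_fibers_le : (K <= #|A|)%N.
Proof. by have [_ qK _] := Kq; rewrite -(qK point) max_card. Qed.

(** Given a value j of Z at Phi a, the set of possible letters is known and
    they have equal masses: each of the K masses is that of j divided by K. *)
Lemma uniform_fibers_joint_entropy (J : finType) (Z : X -> J) :
  finite_rv Z -> determines Z q ->
  rv_entropy mu (joint (@letter A 0) (Z \o Phi)) =
  rv_entropy mu Z + log2 K%:R.
Proof.
move=> mZ Zq; have [mq qK qE] := Kq.
have [f qf] := determines_comp Zq.
have K0 := uniform_fibers_gt0; have KR : 0 < K%:R :> R by rewrite ltr0n.
have jE w j : mass mu (joint (@letter A 0) (Z \o Phi)) (w, j) =
    if w \in f j then mass mu Z j / K%:R else 0.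
  rewrite /mass (_ : _ @^-1` _ =
      Phi @^-1` (Z @^-1` [set j]) `&` letter 0 @^-1` [set w]); last first.
    apply/seteqP; split=> x /=; first by case=> -> ->.
    by case=> ZE XE; rewrite /joint/= ZE XE.
  rewrite qE//; case: ifP => wj.
    rewrite (_ : _ `&` _ = Z @^-1` [set j]) ?fineM ?fin_num_measure//.
      by rewrite mulrC.
    by apply/seteqP; split=> b /= => [[]//|Zj]; split=> //; rewrite qf/= Zj.
  rewrite (_ : _ `&` _ = set0) ?measure0 ?mule0//.
  by apply/seteqP; split=> // b /= -[Zj]; rewrite qf/= Zj wj.
have eE j : \sum_w neg_xlog (mass mu (joint (@letter A 0) (Z \o Phi)) (w, j)) =
    neg_xlog (mass mu Z j) + mass mu Z j * log2 K%:R.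
  have [p0|pN] := eqVneq (mass mu Z j) 0.
    rewrite p0 mul0r addr0 neg_xlog0 big1// => w _.
    by rewrite jE p0 mul0r if_same neg_xlog0.
  have p0 : 0 < mass mu Z j by rewrite lt_neqAle eq_sym pN mass_ge0.
  have fK : #|f j| = K.
    have [b Zb] : exists b, Z b = j.
      apply/not_existsP => nb; move/eqP: pN; apply.
      rewrite /mass (_ : _ @^-1` _ = set0) ?measure0//.
      by apply/seteqP; split=> // b /nb.
    by rewrite -(qK b) qf /= Zb.
  under eq_bigr do rewrite jE (fun_if neg_xlog) neg_xlog0.
  rewrite -big_mkcond /= sumr_const fK /neg_xlog /log2 ln_div ?posrE//.
  rewrite -mulr_natl; field.
  by rewrite (gt_eqF KR) (gt_eqF ln2_gt0).
transitivity (\sum_j \sum_w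
    neg_xlog (mass mu (joint (@letter A 0) (Z \o Phi)) (w, j))).
  by rewrite exchange_big pair_bigA; apply: eq_bigr => -[].
under eq_bigr do rewrite eE.
by rewrite big_split/= -mulr_suml mass_sum1// mul1r.
Qed.

End uniform_fibers_theory.

End fiber_letters.

(** * Entropy of the automaton *)

Section main.
Variables (A : finPointedType) (op : A -> A -> A).
Hypothesis opQ : quasigroup_law op.
Local Notation X := (borel_config A).
Local Notation Phi := (quasigroup_ca op).
Local Notation sigma := (@config_shift A).
Context {R : realType} (mu : probability X R).
Hypothesis inv_Phi : invariant_measure mu Phi.
Variables (K : nat) (q : X -> {set A}).
Hypothesis Kq : uniform_fibers op mu K q.

(** The configurations of positive conditional probability in their fibre. A
    point of the fibre over u is identified with its letter at 0, hence, in the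
    set, with an index in the enumeration of q u. *)
Lemma uniform_fibers_K_to_1 : K_to_1 mu Phi K.
Proof.
have [mq qK qE] := Kq.
pose U : set X := [set a | a 0 \in q (Phi a)].
have mU : measurable U.
  have := finite_rv_joint (@finite_rv_letter A 0) (finite_rv_mfun Phi mq).
  exact: (@finite_rv_preimage _ _ _ _ [set p : A * {set A} | p.1 \in p.2]).
have mqw w : measurable [set b | w \in q b].
  exact: (finite_rv_preimage [set V : {set A} | w \in V] mq).
have NU : mu (~` U) = 0%E.
  rewrite -[LHS]fineK; last by rewrite fin_num_measure//; exact: measurableC.
  rewrite (measure_split mu (@finite_rv_letter A 0)); last exact: measurableC.
  rewrite big1// => w _; rewrite (_ : _ `&` _ =
    Phi @^-1` (~` [set b | w \in q b]) `&` letter 0 @^-1` [set w]).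
    by rewrite qE ?setICl ?measure0 ?mule0//; exact: measurableC.
  by apply/seteqP; split=> a [/= aU aw]; split=> //; move: aU;
    rewrite /U /= -aw.
have negNU : mu.-negligible (~` U).
  by apply/negligibleP => //; exact: measurableC.
exists U; split=> //.
- rewrite -[U]setCK; transitivity (1 - mu (~` U))%E; last by rewrite NU sube0.
  by apply: probability_setC; exact: measurableC.
- apply: negligibleS (negligibleU negNU (invariant_negligible inv_Phi negNU)).
  by move=> a [[_]|[_]]; [left|right].
apply: aeW => u _; apply/card_set_bijP.
exists (fun a : X => index (a 0) (enum (q u))); split.
- by move=> a [Ua /= au]; rewrite -(qK u) cardE index_mem mem_enum -au.
- move=> a b /[!inE] -[Ua /= au] [Ub /= bu] ab.
  apply: (ca_fiber_inj opQ); first by rewrite au bu.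
  have a0q : a 0 \in enum (q u) by rewrite mem_enum -au.
  have b0q : b 0 \in enum (q u) by rewrite mem_enum -bu.
  by rewrite -(nth_index point a0q) ab nth_index.
- move=> i /=; rewrite -(qK u) cardE => iq.
  have [a au a0] := ca_fiber_surj opQ u (nth point (enum (q u)) i).
  exists a; last by rewrite a0 index_uniq// enum_uniq.
  by split=> //; rewrite /U/= au a0 -mem_enum mem_nth.
Qed.

Hypothesis inv_sigma : invariant_measure mu sigma.
Local Notation L := (block_entropy mu).

Lemma approximable_borel (B : set X) :
  measurable B -> approximable mu (@central_window A) B.
Proof.
have mF := @finite_rv_window A.
apply: borel_config_ind.
  apply: approximable_sigma_algebra => [n|]; first exact: mF.
  exact: central_window_le.
move=> n C; apply: approximable_determined => k; exact: mF.
Qed.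

Lemma cond_entropy_central_window (I : finType) (Y : X -> I) (e : R) :
  finite_rv Y -> 0 < e -> exists N, forall n, (N <= n)%N ->
    cond_entropy mu Y (@central_window A n) <= e.
Proof.
move=> mY e0; apply: cond_entropy_approximable => //.
- by move=> n; exact: finite_rv_window.
- exact: central_window_le.
- by move=> i; exact: approximable_borel.
Qed.

(** The increment is the entropy of the letter at 0 given the window F_n after
    one step. Adding q to the window makes it exactly log2 K, and costs at most
    H(q | F_n), which tends to 0. *)
Lemma block_entropy_increment_cvg :
  (L n.+1 - L n) @[n --> \oo] --> log2 (K%:R : R).
Proof.
have [mq qK qE] := Kq; have m0 := @finite_rv_letter A 0.
have mW n : finite_rv (@central_window A n) by exact: finite_rv_window.
have LE n : L n.+1 - L n =
    cond_entropy mu (@letter A 0) (@central_window A n \o Phi).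
  by apply: block_entropyS => //; lia.
pose Z n := joint q (@central_window A n).
have mZ n : finite_rv (Z n) by exact: finite_rv_joint.
have ZE n : cond_entropy mu (@letter A 0) (Z n \o Phi) = log2 K%:R.
  rewrite /cond_entropy (rv_entropy_invariant inv_Phi (mZ n)).
  rewrite (uniform_fibers_joint_entropy inv_Phi Kq (mZ n)).
    by rewrite addrAC subrr add0r.
  exact: determines_jointl.
have lower n : log2 K%:R <= L n.+1 - L n.
  rewrite LE -(ZE n); apply: cond_entropy_le_cond => //.
    exact: finite_rv_mfun.
  by move=> a b [].
have upper n :
    L n.+1 - L n <= log2 K%:R + cond_entropy mu q (@central_window A n).
  rewrite LE -(ZE n).
  apply: le_trans (cond_entropy_triangle mu m0 (finite_rv_mfun Phi (mZ n))
    (finite_rv_mfun Phi (mW n))) _.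
  rewrite lerD2l (cond_entropy_invariant inv_Phi (mZ n) (mW n)).
  by apply: cond_entropy_mono.
apply/cvgrPdist_le => e e0.
have [N NP] := cond_entropy_central_window mq e0.
exists N => // n /= Nn; rewrite ler0_norm ?subr_le0// opprB lerBlDl.
by apply: le_trans (upper n) _; rewrite lerD2l NP.
Qed.

(** Itineraries of the partition are compared with itineraries of a window F_m
    that nearly determines it. *)
Lemma partition_entropy_le (k : nat) (P : 'I_k -> set X) :
  measurable_partition P -> partition_entropy mu Phi P <= log2 K%:R.
Proof.
move=> /partition_rv[Y mY YP].
have cvY := itinerary_entropy_cvg inv_Phi mY.
rewrite /partition_entropy.
under eq_fun do rewrite (itinerary_entropyE _ _ _ YP).
apply/ler_addgt0Pr => e e0.
have [m /(_ m (leqnn m)) Ye] := cond_entropy_central_window mY e0.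
have mW : finite_rv (@central_window A m) by exact: finite_rv_window.
have LmE : (L (m + n)%N / n%:R) @[n --> \oo] --> log2 (K%:R : R).
  apply: cvg_mean_increments.
  rewrite (_ : (fun n => _) = fun n => L (n + m).+1 - L (n + m)).
    rewrite (cvg_shiftn m (fun n => L n.+1 - L n)).
    exact: block_entropy_increment_cvg.
  by apply/funext => n; rewrite addnC -addSn addnC [in X in _ - X]addnC.
have LeE : (L (m + n)%N / n%:R + e) @[n --> \oo] --> log2 (K%:R : R) + e.
  exact: cvgD LmE (cvg_cst _).
apply: (ler_cvg_to cvY LeE); exists 1%N => // n /= n0.
have nR : 0 < n%:R :> R by rewrite ltr0n.
rewrite ler_pdivrMr// mulrDl divfK ?gt_eqF//.
apply: le_trans (itinerary_entropy_le inv_Phi n mY mW) _; apply: lerD.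
  rewrite -(window_entropy inv_sigma m./2).
  apply: determines_entropy_le; first exact: finite_rv_window.
  exact: window_itinerary_window.
by rewrite mulrC ler_wpM2r// ltW.
Qed.

Lemma letter_partition : measurable_partition
  (fun i : 'I_#|A| => letter 0 @^-1` [set enum_val i] : set X).
Proof.
split=> [i|]; first exact: measurable_letter.
split.
- apply/seteqP; split=> // a _; exists (enum_rank (a 0)) => //=.
  by rewrite enum_rankK.
- apply/trivIsetP => i j _ _ /eqP ij; apply/seteqP; split=> // a [/= -> e].
  by apply: ij; exact: enum_val_inj.
- by move=> i _; exists (fun=> enum_val i).
Qed.

(** The itinerary of length n of the letter at 0 and the block of n letters
    determine each other, so the entropies at stake are those of blocks. *)
Lemma letter_partition_entropy : partition_entropy mu Phi
  (fun i : 'I_#|A| => letter 0 @^-1` [set enum_val i] : set X) = log2 K%:R.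
Proof.
pose Y : X -> 'I_#|A| := enum_rank \o letter 0.
have mY : finite_rv Y by apply: finite_rv_comp; exact: finite_rv_letter.
have YP i : Y @^-1` [set i] = letter 0 @^-1` [set enum_val i].
  apply/seteqP; split=> a /= => [<-|aE]; first by rewrite /Y/= enum_rankK.
  by rewrite /Y /= aE enum_valK.
rewrite /partition_entropy.
under eq_fun do rewrite (itinerary_entropyE _ _ _ YP).
apply: cvg_lim => //.
rewrite (_ : (fun n => _) = fun n => L n / n%:R).
  apply: cvg_mean_increments; exact: block_entropy_increment_cvg.
apply/funext => n; congr (_ / _); apply: determines_entropy_eq.
- exact: finite_rv_itinerary.
- exact: finite_rv_window.
- move=> a b /window_itinerary_letter ab; apply: itinerary_determines (ab op).
  by move=> x y xy; rewrite /Y /= xy.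
- move=> a b ab; apply: (itinerary_window opQ).
  by apply: itinerary_determines ab => x y /enum_rank_inj.
Qed.

Lemma uniform_fibers_entropy : entropy mu Phi = (log2 (K%:R : R))%:E.
Proof.
apply/eqP; rewrite eq_le; apply/andP; split.
  apply: ge_ereal_sup => _ [k [P [mP ->]]].
  by rewrite lee_fin partition_entropy_le.
rewrite -letter_partition_entropy; apply: ereal_sup_ubound.
by eexists; eexists; split; first exact: letter_partition.
Qed.

End main.

Theorem theorem22 (R : realType) (A : finPointedType) (op : A -> A -> A)
    (N : nat) (mu : probability (borel_config A) R) :
  quasigroup_law op ->
  #|A| = N ->
  invariant_measure mu (quasigroup_ca op) ->
  ergodic_measure mu (@config_shift A) ->
  exists K : nat,
    [/\ (1 <= K <= N)%N,
        entropy mu (quasigroup_ca op) = (log2 (K%:R : R))%:E &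
        K_to_1 mu (quasigroup_ca op) K].
Proof.
move=> opQ AN inv_Phi erg.
have [K [q Kq]] := uniform_fibers_exist opQ inv_Phi erg.
exists K; split.
- rewrite -AN (uniform_fibers_gt0 inv_Phi Kq).
  exact: uniform_fibers_le Kq.
- exact: (uniform_fibers_entropy opQ inv_Phi Kq (proj1 erg)).
- exact: (uniform_fibers_K_to_1 opQ inv_Phi Kq).
Qed.
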